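(* There exist $c>0$ and $n_0\ge 2$ for which the following holds. For all integers $n\ge n_0$ and $1\le d\le cn/\log^2 n$, every $n$-vertex graph $G$ with minimum degree $\delta(G)\ge \frac{n+2d}{2}-1$ is $d$-rigid.
   Context: Graphs are finite and simple; $\delta(G)$ denotes the minimum degree of $G$; $\log$ is the natural logarithm and $\log^2 n=(\log n)^2$. A $d$-dimensional framework is a pair $(G,\mathbf{p})$ with $G=(V,E)$ a graph and $\mathbf{p}:V\to\mathbb{R}^d$. It is rigid if every continuous motion of the vertices starting from $\mathbf{p}$ that preserves the distances between all pairs of adjacent vertices is trivial (arises from translations and rotations of the whole framework). $\mathbf{p}$ is generic if its $d|V|$ coordinates are algebraically independent over $\mathbb{Q}$. $G$ is $d$-rigid if $(G,\mathbf{p})$ is rigid for a generic $\mathbf{p}$ (this does not depend on the generic $\mathbf{p}$). It is assumed that $|V|\ge d+1$ when discussing $d$-rigidity. Equivalently (Asimow–Roth), $G$ is $d$-rigid if, for a generic $\mathbf{p}$, the rigidity matrix $\mathsf{R}(G,\mathbf{p})$ has rank $d|V|-\binom{d+1}{2}$ (the maximum possible), where $\mathsf{R}(G,\mathbf{p})$ has rows indexed by $E$, columns indexed by $V\times[d]$, and the entry in row $e$ and column $(u,i)$ is $\mathbf{p}(u)_i-\mathbf{p}(v)_i$ if $e=\{u,v\}$ for some $v\in V$, and $0$ if $u\notin e$. *)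

(* Defs.v *)
From HB Require Import structures.
From mathcomp Require Import all_boot all_order all_algebra.
From mathcomp Require Import all_classical all_reals all_analysis.
From mathcomp Require Import -(notations) mpoly.
Import Order.TTheory GRing.Theory Num.Theory numFieldNormedType.Exports.

Set Implicit Arguments.
Unset Strict Implicit.
Unset Printing Implicit Defensive.

Local Open Scope classical_set_scope.
Local Open Scope ring_scope.

Section Graphs.
Variables (V : finType) (e : rel V).

Definition degree (v : V) : nat := #|[set u | e v u]%SET|.

(* The default #|V| exceeds every degree of a loopless graph, so this is the
   minimum of the degrees as soon as V is nonempty. *)
Definition min_degree : nat := \big[minn/#|V|]_(v : V) degree v.

End Graphs.

Section Rigidity.
Variable R : realType.

Definition alg_independent_rat (I : finType) (x : I -> R) : Prop :=
  forall P : mpoly #|I| rat,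
    mmap (ratr : rat -> R) (fun k => x (enum_val k)) P = 0 -> P = 0.

Variables (V : finType) (d : nat).

(* The library norm on row vectors is the sup norm; lengths are Euclidean. *)
Definition eucl_dist (x y : 'rV[R]_d) : R :=
  Num.sqrt (\sum_(i < d) (x ord0 i - y ord0 i) ^+ 2).

Definition generic (p : V -> 'rV[R]_d) : Prop :=
  alg_independent_rat (fun k : V * 'I_d => p k.1 ord0 k.2).

Definition preserving_motion (e : rel V) (p : V -> 'rV[R]_d)
    (q : R -> V -> 'rV[R]_d) : Prop :=
  [/\ forall v, {within `[0, 1], continuous (fun t => q t v)},
      forall v, q 0 v = p v
    & forall t, t \in `[0, 1] -> forall u v, e u v ->
        eucl_dist (q t u) (q t v) = eucl_dist (p u) (p v)].

Definition rotation (A : 'M[R]_d) : Prop := A *m A^T = 1%:M /\ \det A = 1.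

Definition trivial_motion (p : V -> 'rV[R]_d) (q : R -> V -> 'rV[R]_d) : Prop :=
  exists (A : R -> 'M[R]_d) (b : R -> 'rV[R]_d),
    [/\ {within `[0, 1], continuous A}, {within `[0, 1], continuous b}
      & forall t, t \in `[0, 1] ->
          rotation (A t) /\ forall v, q t v = p v *m A t + b t].

Definition rigid (e : rel V) (p : V -> 'rV[R]_d) : Prop :=
  forall q, preserving_motion e p q -> trivial_motion p q.

End Rigidity.

(* Rigidity of a generic framework depends only on the graph, so "for a generic
   p" may be read as "for every generic p"; generic p exist because R is
   uncountable. *)
Definition d_rigid (R : realType) (V : finType) (d : nat) (e : rel V) : Prop :=
  forall p : V -> 'rV[R]_d, generic p -> rigid e p.

(* Main.v *)
Require Import Defs.
From HB Require Import structures.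
From mathcomp Require Import -(notations) mpoly.
From mathcomp Require Import all_boot all_order all_algebra.
From mathcomp Require Import zify ring lra.
Set Implicit Arguments.
Unset Strict Implicit.
Unset Printing Implicit Defensive.
Import Order.TTheory GRing.Theory Num.Theory.

(* Color the vertices with d colors so that, for all colors i and j, the edges
   between classes i and j (inside the class when i = j) form a connected graph.
   Placing class i on the i-th coordinate axis then gives an infinitesimally
   rigid framework, hence so is every generic one; and if two frameworks have
   the same edge lengths, their difference is an infinitesimal flex of their
   midpoint, so a continuous motion of an infinitesimally rigid framework stays
   congruent to its start.

   To color: any two vertices are joined by linearly many paths of length two or
   four, except possibly across a partition V = A + B; a random coloring keeps
   all these connections inside every pair of classes.  What may fail is a
   sparse kind of edges (A to B, or inside the larger part), present only
   through the degree surplus: it yields d (or d - 1) disjoint small sets with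
   linearly many neighbors each, found greedily, and giving these sets distinct
   colors supplies the missing edge for every pair of colors. *)

(** * Rigidity-forcing vertex colorings *)

Lemma card_avoiding (V : finType) (d : nat) (S : {set V}) (i : 'I_d) :
  #|[set f : {ffun V -> 'I_d} | [forall v in S, f v != i]]|
    = d.-1 ^ #|S| * d ^ (#|V| - #|S|).
Proof.
pose F (v : V) := [pred j : 'I_d | (v \in S) ==> (j != i)].
have -> : #|[set f : {ffun V -> 'I_d} | [forall v in S, f v != i]]|
          = #|(family F : simpl_pred {ffun V -> 'I_d})|.
  by rewrite cardsE; apply: eq_card => f; rewrite !inE.
rewrite card_family foldrE big_map big_enum /= (bigID (mem S)) /=.
congr (_ * _).
  rewrite -prod_nat_const; apply: eq_bigr => v vS.
  rewrite -[d in d.-1](card_ord d) -(cardC1 i).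
  by apply: eq_card => j; rewrite !inE /= vS.
have -> : #|V| - #|S| = #|~: S| by rewrite -(cardsC S) addKn.
rewrite -prod_nat_const.
rewrite (eq_bigl (mem (~: S))); last by move=> v; rewrite !inE.
apply: eq_bigr => v vS.
rewrite -[RHS](card_ord d).
by apply: eq_card => j; move: (vS : v \in ~: S); rewrite !inE => /negPf ->.
Qed.

Lemma leq_card_bigcup_seq (I : Type) (T : finType) (r : seq I) (A : I -> {set T}) :
  #|\bigcup_(i <- r) A i| <= \sum_(i <- r) #|A i|.
Proof.
elim/big_rec2: _ => [|i m B _ le]; first by rewrite cards0.
by rewrite (leq_trans (leq_card_setU _ _).1) // leq_add2l.
Qed.

(** Union bound: a random coloring misses color [i] on [F :\: U] with probability at most
    [(1 - 1/d)^D], and there are [d * size Fs] pairs of a color and a set. Only vertices off [U] are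
    counted, so prescribing [w] on [U] does no harm. *)
Lemma hitting_coloring (V : finType) (d D : nat) (U : {set V}) (w : V -> 'I_d)
    (Fs : seq {set V}) :
  0 < d -> d * size Fs * d.-1 ^ D < d ^ D ->
  (forall F, F \in Fs -> D <= #|F :\: U|) ->
  exists g : V -> 'I_d, (forall v, v \in U -> g v = w v) /\
    (forall F, F \in Fs -> forall i, exists2 v, v \in F & g v = i).
Proof.
move=> d0 small big.
pose bad F i := [set f : {ffun V -> 'I_d} | [forall v in F :\: U, f v != i]].
have key F i : F \in Fs -> #|bad F i| * d ^ D <= d ^ #|V| * d.-1 ^ D.
  move=> /big FD; rewrite card_avoiding.
  set m := #|_| in FD *.
  have mV : m <= #|V| by apply: max_card.
  have -> : d ^ #|V| = d ^ D * (d ^ (m - D) * d ^ (#|V| - m)).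
    by rewrite -!expnD; congr (_ ^ _); lia.
  have -> : d.-1 ^ m = d.-1 ^ D * d.-1 ^ (m - D) by rewrite -expnD subnKC.
  have le : d.-1 ^ (m - D) <= d ^ (m - D).
    by case: (m - D) => [//|x]; rewrite leq_exp2r // leq_pred.
  nia.
pose allbad := \bigcup_(F <- Fs) \bigcup_i bad F i.
have lt : #|allbad| < #|{ffun V -> 'I_d}|.
  rewrite card_ffun card_ord -(ltn_pmul2r (m := d ^ D)) ?expn_gt0 ?d0 //.
  apply: (@leq_ltn_trans (size Fs * (d * (d ^ #|V| * d.-1 ^ D)))).
    rewrite -sum1_size big_distrl /=.
    apply: leq_trans (leq_mul (leq_card_bigcup_seq _ _) (leqnn _)) _.
    rewrite big_distrl /= big_seq [X in _ <= X]big_seq.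
    apply: leq_sum => F FFs; rewrite mul1n.
    apply: leq_trans (leq_mul (leq_card_bigcup_seq _ _) (leqnn _)) _.
    have -> : d * (d ^ #|V| * d.-1 ^ D) = \sum_(i < d) (d ^ #|V| * d.-1 ^ D).
      by rewrite sum_nat_const card_ord.
    by rewrite big_distrl; apply: leq_sum => i _; apply: key.
  have -> : size Fs * (d * (d ^ #|V| * d.-1 ^ D)) = d ^ #|V| * (d * size Fs * d.-1 ^ D).
    nia.
  by rewrite ltn_pmul2l ?expn_gt0 ?d0.
have [f fgood] : exists f, f \notin allbad.
  apply/existsP; apply: contraTT lt; rewrite negb_exists => /forallP all.
  rewrite -leqNgt; apply/subset_leq_card/subsetP => f _.
  by have := all f; rewrite negbK.
exists (fun v => if v \in U then w v else f v); split => [v -> //|F FFs i].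
have : f \notin bad F i.
  apply: contra fgood => fb; rewrite /allbad bigcup_seq.
  by apply/bigcupP; exists F => //; apply/bigcupP; exists i.
rewrite inE negb_forall => /existsP [v].
rewrite negb_imply negbK inE => /andP[/andP[vU vF] /eqP fv].
by exists v; rewrite // (negPf vU).
Qed.

Lemma sum_card_sections (V : finType) (P S : {set V}) (out : V -> {set V}) :
  \sum_(y in P) #|[set x in S | y \in out x]| = \sum_(x in S) #|out x :&: P|.
Proof.
have cardE (A B : {set V}) : #|A :&: B| = \sum_(x in A) (x \in B : nat).
  rewrite -sum1_card big_mkcond [RHS]big_mkcond; apply: eq_bigr => x _.
  by rewrite inE; do 2!case: (_ \in _).
transitivity (\sum_(y in P) \sum_(x in S) (y \in out x : nat)).
  apply: eq_bigr => y _; rewrite (_ : [set x in S | _] = S :&: [set x | y \in out x]).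
    by rewrite cardE; apply: eq_bigr => x _; rewrite inE.
  by apply/setP => x; rewrite !inE.
by rewrite exchange_big; apply: eq_bigr => x _; rewrite setIC cardE.
Qed.

(** * Greedy selection of disjoint sets with many neighbors *)

Section Greedy.
Variables (V : finType) (X Y : {set V}) (out : V -> {set V}) (s D D' : nat).

(** The sets [out x] are the arcs of a digraph from [X] to [Y], with [s] arcs leaving each vertex of
    [X]; [into y] collects the tails of the arcs entering [y]. *)
Definition into y := [set x in X | y \in out x].
Definition covered (W : {set V}) := \bigcup_(y in W) into y.

Hypothesis s_gt0 : 0 < s.
Hypothesis out_sub : forall x, x \in X -> out x \subset Y.
Hypothesis card_out : forall x, x \in X -> #|out x| = s.
Hypothesis into_le : forall y, y \in Y -> #|into y| <= D'.
Hypothesis X_large : #|V| <= 5 * #|X|.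

Lemma covered_sub W : covered W \subset X.
Proof. by apply/bigcupsP => y _; apply/subsetP => x; rewrite inE => /andP[]. Qed.

(* A new vertex whose arcs come mostly from uncovered vertices exists by
   averaging [#|into y :\: C| - #|into y :&: C|] over the unused part of Y. *)
Lemma exists_efficient (U W : {set V}) :
  2 * (\sum_(y in U) #|into y| + \sum_(y in W) #|into y|) + 4 * s * #|covered W|
    < s * #|X| ->
  exists2 y, y \in Y :\: (U :|: W) &
    s + 10 * #|into y :&: covered W| <= 10 * #|into y :\: covered W|.
Proof.
set C := covered W => lt; apply/exists_inP; apply: contraTT lt.
rewrite negb_exists_in => /forall_inP none; rewrite -leqNgt.
have sumY (S : {set V}) : S \subset X ->
    \sum_(y in Y) #|into y :&: S| = s * #|S|.
  move=> SX; have -> : \sum_(y in Y) #|into y :&: S|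
      = \sum_(y in Y) #|[set x in S | y \in out x]|.
    apply: eq_bigr => y _; apply: eq_card => x; rewrite !inE.
    by case xS: (x \in S); rewrite ?andbF // (subsetP SX x xS) andbT.
  rewrite sum_card_sections mulnC -sum_nat_const; apply: eq_bigr => x xS.
  have xX := subsetP SX x xS.
  by rewrite (setIidPl (out_sub xX)) card_out.
have sC := sumY C (covered_sub W).
have sX : \sum_(y in Y) #|into y :\: C| = s * #|X :\: C|.
  rewrite -sumY ?subsetDl //; apply: eq_bigr => y _; apply: eq_card => x.
  by rewrite !inE; case: (x \in X); rewrite ?andbF ?andbT //= andbC.
have CX : #|X :\: C| + #|C| = #|X|.
  by rewrite -(cardsID C X) (setIidPr (covered_sub W)) addnC.
set Z := Y :\: (U :|: W) in none.
have new_split : \sum_(y in Y) #|into y :\: C| <=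
    \sum_(y in Z) #|into y :\: C| + (\sum_(y in U) #|into y| + \sum_(y in W) #|into y|).
  have le : \sum_(y in Y) #|into y :\: C| <=
     \sum_(y in V) ((y \in Z) * #|into y :\: C| + ((y \in U) * #|into y| + (y \in W) * #|into y|)).
    rewrite big_mkcond; apply: leq_sum => y _; case: ifP => // yY; rewrite !inE yY.
    have := subset_leq_card (subsetDl (into y) C).
    by case: (y \in U); case: (y \in W) => /=; lia.
  apply: leq_trans le _; rewrite !big_split /=.
  rewrite (big_mkcond (mem Z)) (big_mkcond (mem U)) (big_mkcond (mem W)) /=.
  by rewrite !leq_add //; apply: leq_sum => y _; case: (y \in _); rewrite ?mul1n.
have new_old : 10 * \sum_(y in Z) #|into y :\: C| <=
    s * #|V| + 10 * \sum_(y in Y) #|into y :&: C|.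
  rewrite big_distrr /=.
  apply: (@leq_trans (\sum_(y in Z) (s + 10 * #|into y :&: C|))).
    by apply: leq_sum => y yZ; have := none y yZ; rewrite -ltnNge => /ltnW.
  rewrite big_split /= sum_nat_const big_distrr /= leq_add //.
    by rewrite mulnC leq_mul2l max_card orbT.
  rewrite (big_mkcond (mem Z)) (big_mkcond (mem Y)) /=; apply: leq_sum => y _.
  by rewrite inE; case: (y \in Y); rewrite ?andbF //; case: ifP.
(* With [S] the sum of the arcs into [U] and into [W], the bounds give [10 * s * (#|X| - #|C|) <= 10
   * S + 5 * s * #|X| + 10 * s * #|C|], that is, [s * #|X| <= 2 * S + 4 * s * #|C|]. *)
have := leq_mul (leqnn s) X_large.
rewrite sC in new_old; rewrite -CX !mulnDr sX in new_split *; lia.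
Qed.

(** Take [W] of maximal coverage below [D] among sets built efficiently. An efficient vertex at
    least half of whose arcs are new preserves both efficiency bounds, so by maximality adding it
    must reach [D]; this last vertex accounts for the extra [D'] and [s]. *)
Lemma exists_wide (U : {set V}) :
  2 * \sum_(y in U) #|into y| + 4 * D + 4 * s * D < s * #|X| ->
  exists W : {set V}, [/\ W \subset Y :\: U, D <= #|covered W|,
    \sum_(y in W) #|into y| <= 2 * D + D' & s * #|W| <= 10 * D + s].
Proof.
move=> room; case: (posnP D) => [D0|Dpos].
  by exists set0; rewrite sub0set D0 big_set0 cards0 !muln0.
pose good (W : {set V}) := [&& W \subset Y :\: U, #|covered W| < D,
  \sum_(y in W) #|into y| <= 2 * #|covered W| & s * #|W| <= 10 * #|covered W|].
have good0 : good set0.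
  by rewrite /good sub0set /covered !big_set0 !cards0 Dpos !muln0.
have [W /and4P[WY WD Win Ws] Wmax] := arg_maxnP (fun W => #|covered W|) good0.
have [|y] := @exists_efficient U W; first by nia.
rewrite !inE negb_or -andbA => /and3P[yU yW yY] eff.
have cardin : #|into y| = #|into y :&: covered W| + #|into y :\: covered W|.
  by rewrite cardsID.
have covU : covered (y |: W) = into y :|: covered W.
  by rewrite /covered big_setU1.
have cov : #|covered (y |: W)| = #|covered W| + #|into y :\: covered W|.
  rewrite covU -[LHS](cardsID (covered W)); congr (_ + _); apply: eq_card => z.
    by rewrite !inE; case: (z \in covered W); rewrite ?orbT ?andbF.
  by rewrite !inE; case: (z \in covered W); rewrite ?orbF.
have sumU : \sum_(z in y |: W) #|into z| = #|into y| + \sum_(z in W) #|into z|.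
  by rewrite big_setU1.
have subU : y |: W \subset Y :\: U by rewrite subUset sub1set !inE yU yY.
have [big|small] := leqP D #|covered (y |: W)|.
  exists (y |: W); rewrite sumU cardsU1 yW subU big; split => //.
  - by have := into_le yY; lia.
  - nia.
have gy : good (y |: W).
  rewrite /good subU small sumU cov cardsU1 yW /=; apply/andP; split; first by lia.
  nia.
have := Wmax _ gy; rewrite cov; lia.
Qed.

Lemma exists_wide_family (k : nat) : 2500 * D <= #|V| -> D' = 25 * D -> 0 < D -> k <= 2 * s ->
  exists c : V -> nat, let U := [set y | c y < k] in
  [/\ U \subset Y, #|U| <= 20 * D + k &
    forall i, i < k -> D <= #|covered [set y | c y == i]|].
Proof.
move=> Dn D'E D0 ks.
suff main j : j <= k -> exists c : V -> nat, let U := [set y | c y < j] in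
  [/\ U \subset Y, s * #|U| <= j * (10 * D + s),
    \sum_(y in U) #|into y| <= j * (2 * D + D') &
    forall i, i < j -> D <= #|covered [set y | c y == i]|].
  have [c [UY Us _ cov]] := main k (leqnn k); exists c; split => //.
  by rewrite -(leq_pmul2l s_gt0); nia.
elim: j => [|j IH] jk.
  exists (fun=> 0) => /=; have -> : [set y : V | 0 < 0] = set0 by apply/setP => y; rewrite !inE.
  by rewrite sub0set cards0 big_set0 muln0.
have [c /= [UY Us Uin cov]] := IH (ltnW jk); set U := [set y | _] in UY Us Uin.
(* Each earlier set absorbs at most [27 * D] arcs, so together they use at most [54 * s * D] of the
   [s * #|X| >= 500 * s * D] arcs, which leaves room for one more set. *)
have [|W [WY Wcov Win Ws]] := @exists_wide U.
  have : j * (2 * D + D') <= 2 * s * (27 * D) by apply: leq_mul; lia.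
  nia.
pose c' y := if y \in U then c y else if y \in W then j else j.+1.
have WU y : y \in W -> y \notin U by move=> /(subsetP WY); rewrite inE => /andP[].
have U'E : [set y | c' y < j.+1] = U :|: W.
  apply/setP => y; rewrite in_set in_setU /c'; case yU: (y \in U) => /=.
    by move: yU; rewrite inE => /leqW.
  by case: ifP; rewrite ?ltnSn ?ltnn.
have disj : [disjoint U & W].
  by rewrite disjoint_subset; apply/subsetP => y yU; rewrite !inE; apply: contraL yU => /WU.
exists c'; rewrite U'E; split.
- by rewrite subUset UY (subset_trans WY) ?subsetDl.
- by have := (leq_card_setU U W).1; nia.
- have -> : \sum_(y in U :|: W) #|into y|
      = \sum_(y in U) #|into y| + \sum_(y in W) #|into y|.
    by rewrite -bigU //; apply: eq_bigl => y; rewrite in_setU.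
  nia.
move=> i; rewrite ltnS leq_eqVlt => /predU1P [->|ij].
  have -> : [set y | c' y == j] = W.
    apply/setP => y; rewrite !in_set /c'; case yU: (y \in U).
      have /negPf -> : y \notin W by apply/negP => /WU; rewrite yU.
      by move: yU; rewrite inE; case: eqP => // ->; rewrite ltnn.
    by case: ifP; rewrite ?eqxx // gtn_eqF.
  exact: Wcov.
have -> : [set y | c' y == i] = [set y | c y == i]; last exact: cov.
apply/setP => y; rewrite !in_set /c'; case yU: (y \in U) => //.
have /negPf -> : c y != i.
  by apply/eqP => cy; move: yU; rewrite inE cy ij.
by case: ifP => _; apply: gtn_eqF; lia.
Qed.
End Greedy.

(** * Wide sets across a bipartition and inside one part *)

Lemma exists_subset_of_card (T : finType) (A : {set T}) (m : nat) :
  m <= #|A| -> exists2 B : {set T}, B \subset A & #|B| = m.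
Proof.
move=> mA; exists [set x in take m (enum A)].
  by apply/subsetP => x; rewrite inE => /mem_take; rewrite mem_enum.
rewrite cardsE (card_uniqP _) ?take_uniq ?enum_uniq // size_takel //.
by rewrite -cardE.
Qed.

(** This makes the graph inside [C] bipartite, as the greedy selection requires, while every vertex
    keeps at least half of its degree. *)
Lemma exists_balanced_cut (V : finType) (e : rel V) (C : {set V}) :
  symmetric e -> irreflexive e ->
  exists2 S : {set V}, S \subset C & forall x, x \in C ->
    #|[set y in C | e x y]| <=
      2 * #|[set y in if x \in S then C :\: S else S | e x y]|.
Proof.
move=> esym eirr.
pose cut (S : {set V}) := \sum_(x in S) #|[set y in C :\: S | e x y]|.
have sub0 : set0 \subset C by rewrite sub0set.
(* In a maximum cut, moving [x] to the other side gains nothing. *)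
have [S SC Smax] := @arg_maxnP _ set0 (fun S : {set V} => S \subset C) cut sub0.
(* A cut has the same size from either side, so it suffices to treat the vertices of the chosen
   side. *)
have cutC (T : {set V}) : T \subset C -> cut T = cut (C :\: T).
  move=> TC; rewrite /cut setDDr setDv set0U (setIidPr TC).
  pose out x := [set y | e x y].
  transitivity (\sum_(x in T) #|out x :&: (C :\: T)|).
    by apply: eq_bigr => x _; apply: eq_card => y; rewrite !inE andbC.
  rewrite -sum_card_sections; apply: eq_bigr => y _; apply: eq_card => x.
  by rewrite !inE esym.
have main (T : {set V}) x : T \subset C -> (forall S' : {set V}, S' \subset C -> cut S' <= cut T) ->
    x \in T -> #|[set y in C | e x y]| <= 2 * #|[set y in C :\: T | e x y]|.
  move=> TC Tmax xT.
  have splitC : #|[set y in C | e x y]|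
      = #|[set y in C :\: T | e x y]| + #|[set y in T :\ x | e x y]|.
    rewrite -(cardsID T) addnC; congr (_ + _); apply: eq_card => y; rewrite !inE.
      by case: (y \in T); rewrite ?andbT ?andbF.
    have [->|yx] /= := eqVneq y x; first by rewrite eirr !andbF.
    case yT: (y \in T); rewrite ?andbF //=.
    by rewrite (subsetP TC _ yT) andbT.
  have := Tmax (T :\ x) (subset_trans (subsetDl _ _) TC).
  have -> : cut T = #|[set y in C :\: T | e x y]| +
      \sum_(z in T :\ x) #|[set y in C :\: T | e z y]| by rewrite /cut (big_setD1 x).
  have -> : cut (T :\ x) = \sum_(z in T :\ x) #|[set y in C :\: T | e z y]|
      + #|[set y in T :\ x | e x y]|.
    rewrite -[in RHS]sum1_card /cut [X in _ = _ + X](_ : _ = \sum_(z in T :\ x) (e x z : nat)).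
      rewrite -big_split /=; apply: eq_bigr => z; rewrite !inE => /andP[zx zT].
      rewrite (cardsD1 x) !inE (subsetP TC _ xT) eqxx /= esym addnC; congr (_ + _).
      apply: eq_card => y; rewrite !inE; case: (eqVneq y x) => [->|//].
      by rewrite xT.
    rewrite big_mkcond [RHS]big_mkcond; apply: eq_bigr => z _; rewrite !inE.
    by case: eqP; case: (z \in T); case: (e x z).
  lia.
exists S => // x xC; case: ifP => [xS|xS]; first exact: main.
have := main (C :\: S) x; rewrite setDDr setDv set0U (setIidPr SC); apply.
- exact: subsetDl.
- by move=> S' S'C; rewrite -cutC //; apply: Smax.
- by rewrite inE xS.
Qed.

(* The constants: [25 * D] is what counts as many common neighbors, [D] is what
   remains of such a set once the wide sets are removed, since these occupy at
   most [20 * D + k] vertices. *)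
Section WideSets.
Variables (V : finType) (e : rel V) (D k : nat).
Hypotheses (D_gt0 : 0 < D) (Dn : 2500 * D <= #|V|) (kD : k <= D).

(** Each [x] keeps exactly [s] of its neighbors in [Y]; the out-degrees become uniform and the
    in-degrees can only drop, so the greedy selection applies. *)
Lemma wide_sets_bounded (X Y : {set V}) (s k' : nat) :
  0 < s -> k' <= 2 * s -> #|V| <= 5 * #|X| ->
  (forall x, x \in X -> s <= #|[set y in Y | e x y]|) ->
  (forall y, y \in Y -> #|[set x in X | e x y]| <= 25 * D) ->
  exists c : V -> nat, let U := [set y | c y < k'] in
  [/\ U \subset Y, #|U| <= 20 * D + k' &
    forall i, i < k' -> D <= #|[set x in X | [exists y, e x y && (c y == i)]]|].
Proof.
move=> s0 k's XV degX degY.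
have /fin_all_exists [out outP] : forall x, exists A : {set V},
    x \in X -> A \subset [set y in Y | e x y] /\ #|A| = s.
  move=> x; case xX: (x \in X); last by exists set0.
  by have [A] := exists_subset_of_card (degX x xX); exists A.
have outY x : x \in X -> out x \subset Y.
  by move=> /outP [sub _]; apply: subset_trans sub _; apply/subsetP=> y; rewrite inE => /andP[].
have cardout x : x \in X -> #|out x| = s by move=> /outP [].
have into_le y : y \in Y -> #|into X out y| <= 25 * D.
  move=> yY; apply: leq_trans (degY y yY); apply/subset_leq_card/subsetP => x.
  rewrite !inE => /andP[xX yx]; rewrite xX /=; have [/subsetP sub _] := outP x xX.
  by have := sub y yx; rewrite inE => /andP[].
have [c /= [UY Us cov]] := exists_wide_family s0 outY cardout into_le XV Dn erefl D_gt0 k's.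
exists c; split => // i ik; apply: leq_trans (cov i ik) _.
apply/subset_leq_card/subsetP => x /bigcupP [y]; rewrite !inE => cy /andP[xX yx].
rewrite xX /=; apply/existsP; exists y; rewrite cy andbT.
by have [/subsetP sub _] := outP x xX; have := sub y yx; rewrite inE => /andP[].
Qed.

(* Vertices of large degree ("hubs") are wide on their own; once they are set
   aside the degrees are bounded and the greedy construction applies. *)
Lemma wide_sets (X0 Y0 : {set V}) :
  (forall H : {set V}, H \subset Y0 -> #|H| < k -> exists (X Y : {set V}) (s : nat),
     [/\ X \subset X0 :\: H, Y \subset Y0 :\: H, [disjoint X & Y], 0 < s & k - #|H| <= 2 * s] /\
     #|V| <= 5 * #|X| /\ forall x, x \in X -> s <= #|[set y in Y | e x y]|) ->
  exists c : V -> nat, let U := [set y | c y < k] in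
  [/\ U \subset Y0, #|U| <= 20 * D + k &
    forall i, i < k ->
      D <= #|[set x in X0 | [exists y, e x y && (c y == i)]] :\: U|].
Proof.
move=> split.
pose H := [set y in Y0 | 25 * D < #|[set x in X0 | e x y]|].
have HY : H \subset Y0 by apply/subsetP => y; rewrite inE => /andP[].
pose idx y := index y (enum H).
have idxH y : y \in H -> idx y < #|H| by move=> yH; rewrite cardE index_mem mem_enum.
have idxN y : y \notin H -> idx y = #|H|.
  by move=> yH; rewrite /idx memNindex ?mem_enum // -cardE.
have exH i : i < #|H| -> exists2 y, y \in H & idx y = i.
  move=> iH; have [y0 y0H] : exists y, y \in H by apply/card_gt0P; lia.
  exists (nth y0 (enum H) i); first by rewrite -mem_enum mem_nth // -cardE.
  by rewrite /idx index_uniq ?enum_uniq // -cardE.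
(* A hub has more than [25 * D] neighbors, and [U] removes at most [20 * D + k <= 21 * D] of
   them. *)
have hub (U : {set V}) y : #|U| <= 20 * D + k -> y \in H ->
    D <= #|[set x in X0 | e x y] :\: U|.
  move=> Us; rewrite inE => /andP[_].
  have := cardsID U [set x in X0 | e x y].
  have := subset_leq_card (subsetIr [set x in X0 | e x y] U).
  lia.
have [kH|Hk] := leqP k #|H|.
  exists idx; set U := [set y | _] => /=.
  have UH : U \subset H.
    apply/subsetP => y; rewrite inE; apply: contraLR => /idxN ->; lia.
  have Uk : #|U| <= k.
    have sub : U \subset [set y in take k (enum H)].
      apply/subsetP => y yU; have yH := subsetP UH y yU.
      move: yU; rewrite !inE => yk.
      have yE : y \in enum H by rewrite mem_enum.
      rewrite -(nth_index y yE) -(nth_take _ yk) mem_nth // size_takel // -cardE //.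
    apply: leq_trans (subset_leq_card sub) _; rewrite cardsE.
    by apply: leq_trans (card_size _) _; rewrite size_take; case: ltnP.
  split; [exact: subset_trans UH HY | lia |] => i ik.
  have [y yH yi] := exH i (leq_trans ik kH).
  apply: leq_trans (hub U y _ yH) _; first lia.
  apply/subset_leq_card/setSD/subsetP => x; rewrite !inE => /andP[-> exy] /=.
  by apply/existsP; exists y; rewrite exy yi eqxx.
have [X [Y [s [[XX YY XY s0 ks] [XV degX]]]]] := split H HY Hk.
have [|c' /= [UY Us cov]] := wide_sets_bounded s0 ks XV degX.
  move=> y /(subsetP YY); rewrite !inE => /andP[+ yY0]; rewrite yY0 /= -leqNgt.
  apply: leq_trans; apply/subset_leq_card/subsetP => x; rewrite !inE => /andP[xX ->].
  by have := subsetP XX x xX; rewrite inE => /andP[_ ->].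
set k' := k - #|H| in Us UY cov ks.
(* The greedy sets take the indices below [k'], the hubs the next [#|H|] indices as singletons; the
   value [k] marks vertices in no set. *)
pose c y := if y \in H then k' + idx y else if c' y < k' then c' y else k.
have YH y : y \in Y -> y \notin H by move=> /(subsetP YY); rewrite inE => /andP[].
have UE : [set y | c y < k] = [set y | c' y < k'] :|: H.
  apply/setP => y; rewrite in_set in_setU in_set /c.
  case yH: (y \in H).
    by rewrite orbT; have := idxH y yH; rewrite /k'; lia.
  by rewrite orbF; case: ifP; rewrite ?ltnn // /k'; lia.
exists c; rewrite UE /=; have Usize : #|[set y | c' y < k'] :|: H| <= 20 * D + k.
  by have := (leq_card_setU [set y | c' y < k'] H).1; rewrite /k' in Us *; lia.
split => //.
  by rewrite subUset HY (subset_trans UY) ?(subset_trans YY) ?subsetDl.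
move=> i ik; have [ik'|k'i] := ltnP i k'.
  apply: leq_trans (cov i ik') _; apply/subset_leq_card/subsetP => x.
  rewrite in_set => /andP[xX /existsP[y /andP[exy /eqP cy]]].
  have := subsetP XX x xX; rewrite in_setD => /andP[xH xX0].
  rewrite in_setD in_setU negb_or xH andbT; apply/andP; split.
    by apply: contraL xX => /(subsetP UY); apply: contraL => xX; rewrite (disjointFr XY).
  rewrite in_set xX0; apply/existsP; exists y; rewrite exy /c.
  have yU : y \in [set y | c' y < k'] by rewrite inE cy.
  by rewrite (negPf (YH y (subsetP UY y yU))) cy ik' eqxx.
have [|y yH yi] := exH (i - k'); first by rewrite /k' in k'i *; lia.
apply: leq_trans (hub _ y Usize yH) _.
apply/subset_leq_card/setSD/subsetP => x; rewrite !in_set => /andP[-> exy] /=.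
by apply/existsP; exists y; rewrite exy /c yH yi subnKC ?eqxx.
Qed.

Lemma wide_sets_cross (A B : {set V}) :
  [disjoint A & B] -> #|V| <= 5 * #|A| ->
  (forall x, x \in A -> k <= #|[set y in B | e x y]|) ->
  exists c : V -> nat, let U := [set y | c y < k] in
  [/\ U \subset B, #|U| <= 20 * D + k &
    forall i, i < k -> D <= #|[set x in A | [exists y, e x y && (c y == i)]] :\: U|].
Proof.
move=> AB AV deg; apply: wide_sets => H HB Hk.
exists A, (B :\: H), (k - #|H|); do !split => //; try lia.
- apply/subsetP => x xA; rewrite inE xA andbT.
  by apply: contraL xA => /(subsetP HB) xB; rewrite (disjointFl AB).
- by apply: disjointWr AB; apply: subsetDl.
- move=> x /deg le; have := cardsID H [set y in B | e x y].
  have := subset_leq_card (subsetIr [set y in B | e x y] H).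
  have -> : [set y in B | e x y] :\: H = [set y in B :\: H | e x y].
    by apply/setP => y; rewrite !inE andbA.
  lia.
Qed.

(** A balanced cut of [B] minus the hubs leaves each vertex at least half of its degree, hence
    [uphalf]; the factor in [k - #|H| <= 2 * s] pays for this loss. The larger side of the cut
    serves as [X], so that it has at least a fifth of all vertices. *)
Lemma wide_sets_inside (B : {set V}) :
  symmetric e -> irreflexive e -> #|V| <= 2 * #|B| ->
  (forall x, x \in B -> k <= #|[set y in B | e x y]|) ->
  exists c : V -> nat, let U := [set y | c y < k] in
  [/\ U \subset B, #|U| <= 20 * D + k &
    forall i, i < k -> D <= #|[set x in B | [exists y, e x y && (c y == i)]] :\: U|].
Proof.
move=> esym eirr BV deg; apply: wide_sets => H HB Hk.
have [S SC cut] := exists_balanced_cut (B :\: H) esym eirr.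
set C := B :\: H in SC cut.
have degC x : x \in C -> k - #|H| <= #|[set y in C | e x y]|.
  rewrite inE => /andP[_ /deg] le; have := cardsID H [set y in B | e x y].
  have := subset_leq_card (subsetIr [set y in B | e x y] H).
  have -> : [set y in B | e x y] :\: H = [set y in B :\: H | e x y].
    by apply/setP => y; rewrite !inE andbA.
  rewrite -/C; lia.
have sizeC : #|C| = #|B| - #|H| by rewrite cardsD (setIidPr HB).
have sizeS := cardsID S C; rewrite (setIidPr SC) in sizeS.
have [big|small] := leqP #|C :\: S| #|S|.
- exists S, (C :\: S), (uphalf (k - #|H|)); do !split => //; try lia.
  + exact: subsetDl.
  + by rewrite -setI_eq0; apply/eqP/setP => y; rewrite !inE; case: (y \in S); rewrite ?andbF.
  + move=> x xS; have xC := subsetP SC x xS.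
    by have := cut x xC; have := degC x xC; rewrite xS; lia.
- exists (C :\: S), S, (uphalf (k - #|H|)); do !split => //; try lia.
  + exact: subsetDl.
  + by rewrite -setI_eq0; apply/eqP/setP => y; rewrite !inE; case: (y \in S); rewrite ?andbF.
  + move=> x; rewrite inE => /andP[/negPf xS xC].
    by have := cut x xC; have := degC x xC; rewrite xS; lia.
Qed.
End WideSets.

(* A path-free form of: the edges between classes [i] and [j] connect all the
   vertices of these two classes. *)
Definition color_linked (V : finType) (e : rel V) (d : nat) (g : V -> 'I_d) :=
  forall (T : Type) (phi : V -> T) (i j : 'I_d),
    (forall x y, g x = i -> g y = j -> e x y -> phi x = phi y) ->
    forall x y, g x \in [:: i; j] -> g y \in [:: i; j] -> phi x = phi y.

(** * Robust connections by paths of length two and four *)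

Section Structure.
Variables (V : finType) (e : rel V).

Definition nbrs x := [set y | e x y].
Definition hits (d : nat) (g : V -> 'I_d) (F : {set V}) :=
  forall i, exists2 v, v \in F & g v = i.

Variable E : nat.

(** [linked] asks for [E] paths of length two. A vertex of [both x y] is the midpoint of many paths
    of length four, so [robust] pairs are joined by many paths of length two or four. *)
Definition linked x y := E <= #|nbrs x :&: nbrs y|.
Definition both x y := [set z | linked x z && linked z y].
Definition robust x y := linked x y || (E <= #|both x y|).

Lemma linked_sym : symmetric linked.
Proof. by move=> x y; rewrite /linked setIC. Qed.

Hypothesis esym : symmetric e.

Lemma sum_degrees (P : {set V}) :
  \sum_(v in P) #|nbrs v| = \sum_z #|nbrs z :&: P|.
Proof.
transitivity (\sum_(v in P) #|[set z in [set: V] | v \in nbrs z]|).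
  by apply: eq_bigr => v _; apply: eq_card => z; rewrite !inE esym.
by rewrite sum_card_sections; apply: eq_bigl => z; rewrite inE.
Qed.

Lemma sum_le_split (f : V -> nat) (S : {set V}) (a b : nat) :
  (forall z, z \notin S -> f z <= a) -> (forall z, f z <= b) ->
  \sum_z f z <= #|V| * a + #|S| * b.
Proof.
move=> fa fb; rewrite (bigID (mem S)) /= addnC leq_add //.
  apply: (@leq_trans (\sum_(z | z \notin S) a)); first exact: leq_sum.
  by rewrite sum_nat_const leq_mul2r max_card orbT.
by rewrite -sum_nat_const; apply: leq_sum.
Qed.

(* If [x0] and [y0] are not robustly linked, their neighbourhoods nearly
   partition [V], and the vertices split according to which of the two
   neighbourhoods they see. *)
Lemma two_robust_groups :
  0 < E -> 100 * E <= #|V| -> (forall x, #|V| <= 2 * #|nbrs x|) ->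
  exists A : {set V}, [/\ {in A &, forall x y, robust x y},
    {in ~: A &, forall x y, robust x y} &
    A = setT \/ (2 * E <= #|A| /\ 2 * E <= #|~: A|)].
Proof.
move=> E0 En deg; set n := #|V| in En deg *.
have [/forallP all|] := boolP [forall x, forall y, robust x y].
  exists setT; split; last by left.
    by move=> x y _ _; have /forallP := all x; apply.
  by move=> x y; rewrite !inE.
rewrite negb_forall => /existsP [x0]; rewrite negb_forall => /existsP [y0].
rewrite negb_or -!ltnNge => /andP[x0y0 Zsmall].
pose a z := #|nbrs z :\: nbrs y0|; pose b z := #|nbrs z :&: nbrs y0|.
have ab z : b z + a z = #|nbrs z| by rewrite cardsID.
set P := ~: nbrs y0; have cP : #|nbrs y0| + #|P| = n by rewrite cardsC.
(* Vertices of [X] miss at most [E] vertices of [P]; vertices of [Y] have fewer than [2 * E]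
   neighbors in [P] and so see almost all of [nbrs y0]. Only the few vertices of [both x0 y0] lie in
   neither set. *)
pose X := [set z | ~~ linked z y0]; pose Y := [set z | ~~ linked z x0].
have bX z : z \in X -> b z < E by rewrite inE -ltnNge.
have cI z : #|P :&: nbrs z| = a z by apply: eq_card => y; rewrite !inE andbC.
have PX z : z \in X -> #|P :\: nbrs z| <= E.
  move=> /bX; have := cardsID (nbrs z) P; rewrite cI.
  by have := ab z; have := deg z; have := deg y0; lia.
have x0X : x0 \in X by rewrite inE -ltnNge.
have Pbig : n <= 2 * #|P| + 2 * E.
  have := cardsID (nbrs x0) P; rewrite cI.
  by have := bX _ x0X; have := ab x0; have := deg x0; lia.
have aY z : z \in Y -> a z < 2 * E.
  rewrite inE -ltnNge => zx.
  have : #|nbrs z :\: nbrs y0| <= #|(nbrs z :&: nbrs x0) :|: (P :\: nbrs x0)|.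
    apply/subset_leq_card/subsetP => v; rewrite !inE => /andP[-> ->].
    by case: (e x0 v).
  have := (leq_card_setU (nbrs z :&: nbrs x0) (P :\: nbrs x0)).1.
  by have := PX _ x0X; rewrite /a; lia.
(* A vertex with at least [n / 5] neighbors in [P] shares many of them with every [x] in [X]; any
   other vertex has many neighbors in [nbrs y0] and shares them with every [y] in [Y]. The set [A]
   below is cut out by this threshold. *)
have linkX z x : n <= 5 * a z -> x \in X -> linked z x.
  move=> az /PX; rewrite /linked.
  have : #|nbrs z :\: nbrs y0| <= #|(nbrs z :&: nbrs x) :|: (P :\: nbrs x)|.
    apply/subset_leq_card/subsetP => v; rewrite !inE => /andP[-> ->].
    by case: (e x v).
  have := (leq_card_setU (nbrs z :&: nbrs x) (P :\: nbrs x)).1.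
  by rewrite /a in az; lia.
have linkY z y : 5 * a z < n -> y \in Y -> linked z y.
  move=> az /aY; rewrite /linked.
  have : b z <= #|(nbrs z :&: nbrs y) :|: (nbrs y0 :\: nbrs y)|.
    apply/subset_leq_card/subsetP => v; rewrite !inE => /andP[-> ->].
    by case: (e y v).
  have := (leq_card_setU (nbrs z :&: nbrs y) (nbrs y0 :\: nbrs y)).1.
  have := cardsID (nbrs y) (nbrs y0); have := ab y; rewrite /b setIC.
  by have := ab z; have := deg z; have := deg y; rewrite /b; lia.
have coverV z : z \in X \/ z \in Y \/ z \in both x0 y0.
  rewrite !inE [linked x0 z]linked_sym.
  by case: (linked z y0); case: (linked z x0); auto.
have NX : #|~: X| <= #|Y| + #|both x0 y0|.
  apply: leq_trans (leq_card_setU _ _).1; apply/subset_leq_card/subsetP => z.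
  rewrite in_setC in_setU => /negPf zX; case: (coverV z) => [|[->|->]]; rewrite ?orbT //.
  by rewrite zX.
have NY : #|~: Y| <= #|X| + #|both x0 y0|.
  apply: leq_trans (leq_card_setU _ _).1; apply/subset_leq_card/subsetP => z.
  rewrite in_setC in_setU => /negPf zY; case: (coverV z) => [->|[|->]]; rewrite ?orbT //.
  by rewrite zY.
have degsum (S : {set V}) : n * #|S| <= 2 * \sum_(v in S) #|nbrs v|.
  rewrite mulnC -sum_nat_const big_distrr /=; apply: leq_sum => v _; exact: deg.
(* If [Y] were small, almost every vertex would lie in [X] and send fewer than [E] edges to
   [nbrs y0], against the degree sum over [nbrs y0]. The bound on [X] is the same argument with
   [P]. *)
have Ybig : 2 * E <= #|Y|.
  rewrite leqNgt; apply/negP => Ysmall.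
  have := degsum (nbrs y0); rewrite sum_degrees.
  have : \sum_z #|nbrs z :&: nbrs y0| <= n * E + #|~: X| * n.
    apply: sum_le_split => z; last exact: max_card.
    by rewrite inE negbK => /bX /ltnW.
  have := deg y0; have : #|~: X| <= 3 * E by lia.
  nia.
have Xbig : 2 * E <= #|X|.
  rewrite leqNgt; apply/negP => Xsmall.
  have := degsum P; rewrite sum_degrees.
  have : \sum_z #|nbrs z :&: P| <= n * (2 * E) + #|~: Y| * n.
    apply: sum_le_split => z; last exact: max_card.
    by rewrite inE negbK setIC cI => /aY /ltnW.
  have : #|~: Y| <= 3 * E by lia.
  nia.
exists [set z | n <= 5 * a z]; split.
- move=> z1 z2; rewrite !inE => az1 az2; apply/orP; right.
  apply: (@leq_trans #|X|); first by lia.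
  apply/subset_leq_card/subsetP => x xX.
  by rewrite inE linkX // linked_sym linkX.
- move=> z1 z2; rewrite !inE -!ltnNge => az1 az2; apply/orP; right.
  apply: (@leq_trans #|Y|); first by lia.
  apply/subset_leq_card/subsetP => y yY.
  by rewrite inE linkY // linked_sym linkY.
- right; split.
    apply: leq_trans Xbig _; apply/subset_leq_card/subsetP => x xX.
    by rewrite inE; have := bX x xX; have := ab x; have := deg x; lia.
  apply: leq_trans Ybig _; apply/subset_leq_card/subsetP => y yY.
  by rewrite !inE -ltnNge; have := aY y yY; lia.
Qed.

Section Connecting.
Variables (d : nat) (g : V -> 'I_d).
Hypothesis hit_common : forall x y, linked x y -> hits g (nbrs x :&: nbrs y).
Hypothesis hit_both : forall x y, E <= #|both x y| -> hits g (both x y).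

(** A common neighbor of color [j] gives a path of length two whose edges both join color [i] to
    color [j]. *)
Lemma linked_same_color (T : Type) (phi : V -> T) i j x y :
  (forall x y, g x = i -> g y = j -> e x y -> phi x = phi y) ->
  g x = i -> g y = i -> linked x y -> phi x = phi y.
Proof.
move=> compat gx gy xy; have [z] := hit_common xy j.
by rewrite !inE => /andP[xz yz] gz; rewrite (compat x z) // (compat y z).
Qed.

(** For a path of length four, choosing a midpoint of color [i] reduces to two paths of length
    two. *)
Lemma robust_same_color (T : Type) (phi : V -> T) i j x y :
  (forall x y, g x = i -> g y = j -> e x y -> phi x = phi y) ->
  g x = i -> g y = i -> robust x y -> phi x = phi y.
Proof.
move=> compat gx gy /orP[|big]; first exact: linked_same_color compat gx gy.
have [z] := hit_both big i; rewrite inE => /andP[xz zy] gz.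
rewrite (linked_same_color compat gx gz xz).
exact: linked_same_color compat gz gy zy.
Qed.

(** [linked x x] bounds the degree of [x] below, so [x] has a neighbor of every color; this moves
    from one class to the other, and robustness does the rest. *)
Lemma color_linked_one_group :
  (forall x, linked x x) -> (forall x y, robust x y) -> color_linked e g.
Proof.
move=> lk rob T phi i j compat.
have compat' x y : g x = j -> g y = i -> e x y -> phi x = phi y.
  by move=> gx gy xy; symmetry; apply: compat => //; rewrite esym.
have main x y : g x = i -> g y = j -> phi x = phi y.
  move=> gx gy; have [z] := hit_common (lk x) j; rewrite setIid inE => xz gz.
  by rewrite (compat x z) // (robust_same_color compat' gz gy).
move=> x y; rewrite !inE => /orP[]/eqP gx /orP[]/eqP gy; last 1 first.
- exact: robust_same_color compat' gx gy _.
- exact: robust_same_color compat gx gy _.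
- exact: main.
- by rewrite (main y x).
Qed.

(** Robustness connects each of the four pieces given by a color [i] or [j] and a side of [A];
    [cross] then ties the pieces together by one representative of each. *)
Lemma color_linked_two_groups (A : {set V}) :
  {in A &, forall x y, robust x y} -> {in ~: A &, forall x y, robust x y} ->
  (forall (T : Type) (phi : V -> T) (i j : 'I_d),
    (forall x y, g x = i -> g y = j -> e x y -> phi x = phi y) ->
    (forall x y, g x = i -> g y = i -> (x \in A) = (y \in A) -> phi x = phi y) ->
    (forall x y, g x = j -> g y = j -> (x \in A) = (y \in A) -> phi x = phi y) ->
    exists (a a' b b' : V), [/\ [/\ g a = i, a \in A, g a' = j & a' \in A],
      [/\ g b = i, b \notin A, g b' = j & b' \notin A] &
      [/\ phi a = phi a', phi a = phi b & phi a = phi b']]) ->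
  color_linked e g.
Proof.
move=> robA robB cross T phi i j compat.
have compat' x y : g x = j -> g y = i -> e x y -> phi x = phi y.
  by move=> gx gy xy; symmetry; apply: compat => //; rewrite esym.
have rob x y : (x \in A) = (y \in A) -> robust x y.
  case xA: (x \in A) => yA; first by apply: robA => //; rewrite -yA.
  by apply: robB; rewrite inE ?xA -?yA.
have ci x y : g x = i -> g y = i -> (x \in A) = (y \in A) -> phi x = phi y.
  by move=> gx gy /rob; apply: robust_same_color compat gx gy.
have cj x y : g x = j -> g y = j -> (x \in A) = (y \in A) -> phi x = phi y.
  by move=> gx gy /rob; apply: robust_same_color compat' gx gy.
have [a [a' [b [b' [[ga aA ga' a'A] [gb bA gb' b'A] [aa' ab ab']]]]]] :=
  cross T phi i j compat ci cj.
suff main x : g x \in [:: i; j] -> phi x = phi a by move=> x y /main -> /main ->.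
rewrite !inE => /orP[]/eqP gx; case xA: (x \in A).
- by apply: ci => //; rewrite xA aA.
- by rewrite ab; apply: ci => //; rewrite xA (negPf bA).
- by rewrite aa'; apply: cj => //; rewrite xA a'A.
- by rewrite ab'; apply: cj => //; rewrite xA (negPf b'A).
Qed.
End Connecting.
End Structure.

(** * Linked colorings from the minimum degree *)

Section Coloring.
Variables (V : finType) (e : rel V) (d D : nat).
Hypotheses (esym : symmetric e) (eirr : irreflexive e).
Hypotheses (d_gt0 : 0 < d) (dD : d <= D) (Dn : 2500 * D <= #|V|).
Hypothesis deg : forall x, #|V| + 2 * d <= 2 * #|nbrs e x| + 2.
Hypothesis few : d * (10 * #|V| ^ 2) * d.-1 ^ D < d ^ D.

Local Notation E := (25 * D).
Local Notation N := (nbrs e).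

(** The wide sets get their prescribed colors on [U], and the rest is colored at random. A base set
    of size [25 * D] keeps [D] vertices off [U], as [#|U| <= 21 * D]; base sets and wide
    neighborhoods number at most [10 * #|V| ^ 2]. *)
Lemma hitting_extension (base : seq {set V}) (c : V -> nat) (k : nat) (F : nat -> {set V}) :
  size base <= 9 * #|V| ^ 2 -> k <= d -> #|[set y | c y < k]| <= 20 * D + k ->
  (forall i, i < k -> D <= #|F i :\: [set y | c y < k]|) ->
  exists g : V -> 'I_d, [/\ forall v, c v < k -> g v = c v :> nat,
    forall B, B \in base -> E <= #|B| -> hits g B & forall i, i < k -> hits g (F i)].
Proof.
set U := [set y | _] => sb kd Us Fbig.
pose Fs := [seq B : {set V} <- base | E <= #|B|] ++ [seq F i | i <- iota 0 k].
have sFs : size Fs <= 10 * #|V| ^ 2.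
  rewrite size_cat size_map size_iota size_filter.
  have := count_size (fun B : {set V} => E <= #|B|) base.
  move: kd dD Dn sb; rewrite -mulnn; clear; nia.
have smallFs : d * size Fs * d.-1 ^ D < d ^ D.
  by apply: leq_ltn_trans few; rewrite !leq_mul.
have bigFs B : B \in Fs -> D <= #|B :\: U|.
  rewrite mem_cat => /orP[|/mapP [i]]; last first.
    by rewrite mem_iota => /andP[_ ik] ->; apply: Fbig.
  rewrite mem_filter => /andP[big _].
  by have := cardsID U B; have := subset_leq_card (subsetIr B U); lia.
have [g [gU gF]] := hitting_coloring (fun v => insubd (Ordinal d_gt0) (c v)) d_gt0 smallFs bigFs.
exists g; split.
- by move=> v cv; rewrite gU ?inE // val_insubd (leq_trans cv kd).
- by move=> B Bb big; apply: gF; rewrite mem_cat mem_filter big Bb.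
- move=> i ik; apply: gF; rewrite mem_cat; apply/orP; right.
  by apply/mapP; exists i; rewrite ?mem_iota.
Qed.

Let bV : 0 < #|V|. Proof. lia. Qed.

Definition seeing (A B : {set V}) := [set v in A | E <= #|N v :&: B|].

(** The sets that should meet every color whenever they are large: the first two families serve
    robust pairs, the others produce edges of every color pair between or inside the two sides of
    [A]. *)
Definition large_sets (A : {set V}) : seq {set V} :=
  [seq N x :&: N y | x <- enum {: V}, y <- enum {: V}] ++
  [seq both e E x y | x <- enum {: V}, y <- enum {: V}] ++
  [seq N x :&: A | x <- enum {: V}] ++ [seq N x :&: ~: A | x <- enum {: V}] ++
  [:: seeing A A; seeing (~: A) A; seeing A (~: A); seeing (~: A) (~: A)].

Lemma size_large_sets A : size (large_sets A) <= 9 * #|V| ^ 2.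
Proof.
have sz : size (Finite.enum V) = #|V| by rewrite cardT enumT.
rewrite !size_cat !size_allpairs !size_map !sz -mulnn /=.
by move: bV => /=; nia.
Qed.

Section Hitting.
Variables (A : {set V}) (g : V -> 'I_d).
Hypothesis gA : forall B, B \in large_sets A -> E <= #|B| -> hits g B.

Lemma hits_common x y : linked e E x y -> hits g (N x :&: N y).
Proof.
apply: gA; rewrite mem_cat; apply/orP; left.
by apply/allpairsP; exists (x, y); rewrite !mem_enum.
Qed.

Lemma hits_both x y : E <= #|both e E x y| -> hits g (both e E x y).
Proof.
apply: gA; rewrite !mem_cat; apply/orP; right; apply/orP; left.
by apply/allpairsP; exists (x, y); rewrite !mem_enum.
Qed.

Lemma hits_nbrs x B : B \in [:: A; ~: A] -> E <= #|N x :&: B| -> hits g (N x :&: B).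
Proof.
move=> AB; apply: gA; rewrite !mem_cat; move: AB; rewrite !inE.
move=> /orP[]/eqP ->; do 2![apply/orP; right]; apply/orP; [left|right; apply/orP; left];
  by apply/mapP; exists x; rewrite ?mem_enum.
Qed.

(** First pick [x] of color [i] among the vertices with many neighbors in [B], then a neighbor of
    color [j] there. *)
Lemma edge_of_seeing S B i j :
  S \in [:: A; ~: A] -> B \in [:: A; ~: A] -> E <= #|seeing S B| ->
  exists x y, [/\ g x = i, g y = j, x \in S, y \in B & e x y].
Proof.
move=> SA BA big; have : hits g (seeing S B).
  apply: gA => //; rewrite !mem_cat; do 4![apply/orP; right].
  by move: SA BA; rewrite !inE => /orP[]/eqP -> /orP[]/eqP ->; rewrite eqxx ?orbT.
move=> /(_ i) [x]; rewrite inE => /andP[xS /(hits_nbrs BA) /(_ j) [y]].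
by rewrite !inE => /andP[xy yB] gy gx; exists x, y.
Qed.
End Hitting.

Let E_gt0 : 0 < E. Proof. lia. Qed.

(** If many edges cross between [A] and [B], crossing edges tie the pieces in two pairs and wide
    sets inside [B] join the pairs. Otherwise both sides are dense inside, and wide sets in [B] with
    neighbors in [A] supply a crossing edge. *)
Lemma color_linked_of_two_groups (A : {set V}) :
  {in A &, forall x y, robust e E x y} -> {in ~: A &, forall x y, robust e E x y} ->
  2 * E <= #|A| -> 2 * E <= #|~: A| -> #|A| <= #|~: A| ->
  exists g : V -> 'I_d, color_linked e g.
Proof.
move=> robA robB Abig Bbig AB; set B := ~: A in robB Bbig AB.
have cV : #|A| + #|B| = #|V| by rewrite cardsC.
have inA : A \in [:: A; ~: A] by rewrite inE eqxx.
have inB : B \in [:: A; ~: A] by rewrite !inE eqxx orbT.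
have splitN x : #|N x :&: A| + #|N x :&: B| = #|N x| by rewrite -setDE cardsID.
have card_nbr x (S : {set V}) : #|N x :&: S| = #|[set y in S | e x y]|.
  by apply: eq_card => y; rewrite !inE andbC.
have D0 : 0 < D by lia.
have [dense|/norP[]] := boolP ((E <= #|seeing A B|) || (E <= #|seeing B A|)).
  (* At most [#|A|], hence at most half of [#|V|], of the neighbors lie in [A]. *)
  have degB x : x \in B -> d.-1 <= #|[set y in B | e x y]|.
    move=> xB; rewrite -card_nbr; have := splitN x; have := deg x.
    by have := subset_leq_card (subsetIr (N x) A); lia.
  have kD : d.-1 <= D by lia.
  have BV : #|V| <= 2 * #|B| by lia.
  have [c /= [UB Us cov]] := wide_sets_inside D0 Dn kD esym eirr BV degB.
  have [g [gc gF gW]] := hitting_extension (size_large_sets A) (leq_pred d) Us cov.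
  exists g; apply: (color_linked_two_groups esym (hits_common gF) (hits_both gF) robA robB).
  move=> T phi i j compat ci cj.
  have crossAB i' j' : exists x y, [/\ g x = i', g y = j', x \in A, y \in B & e x y].
    case/orP: dense => [/(edge_of_seeing gF i' j' inA inB) //|].
    move=> /(edge_of_seeing gF j' i' inB inA) [y [x [gy gx yB xA xy]]].
    by exists x, y; rewrite esym.
  have [a [b' [ga gb' aA b'B ab']]] := crossAB i j.
  have [a' [b [ga' gb a'A bB a'b]]] := crossAB j i.
  exists a, a', b, b'.
  have nB x : x \in B -> (x \in A) = false by rewrite inE => /negPf.
  have e1 : phi a = phi b' by apply: compat.
  have e2 : phi b = phi a' by apply: compat; rewrite // esym.
  suff e3 : phi b = phi b' by split=> //; rewrite ?nB // e1 -e3.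
  have [ij|ij] := eqVneq i j.
    rewrite e2 -e1; apply: ci; rewrite ?aA //; congruence.
  (* There are only [d.-1] wide sets, which is enough: of two distinct colors, at least one is not
     the last. *)
  have wide (x0 y0 : 'I_d) : x0 < d.-1 ->
      exists x y, [/\ g x = x0, g y = y0, x \in B, y \in B & e x y].
    move=> x0d; have [y] := gW x0 x0d y0.
    rewrite inE => /andP[yB /existsP [x /andP[yx /eqP cx]]] gy.
    exists x, y; rewrite esym; split => //; first by apply: val_inj; rewrite /= gc cx.
    by apply: (subsetP UB); rewrite inE cx.
  have [id|] := ltnP i d.-1.
    have [x [y [gx gy xB yB xy]]] := wide i j id.
    rewrite (ci b x) ?nB // (compat x y) // (cj y b') //.
    by rewrite !nB.
  move=> di; have jd : j < d.-1.
    by move: ij; rewrite -val_eqE /=; have := ltn_ord i; have := ltn_ord j; lia.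
  have [x [y [gx gy xB yB xy]]] := wide j i jd.
  rewrite (ci b y) ?nB // (compat y x) //; last by rewrite esym.
  by apply: cj => //; rewrite !nB.
(* Sparse crossing: most vertices of each side have nearly all neighbors on their own side, so each
   side is dense inside and [A] has nearly half of the vertices. *)
rewrite -!ltnNge => sAB sBA.
have seeA x : x \in A -> x \notin seeing A B -> #|N x :&: B| < E.
  by move=> xA; rewrite inE xA -ltnNge.
have exS (S B' : {set V}) : 2 * E <= #|S| -> #|seeing S B'| < E ->
    exists x, x \in S :\: seeing S B'.
  move=> Sbig small; apply/card_gt0P; have := cardsID (seeing S B') S.
  by have := subset_leq_card (subsetIr S (seeing S B')); lia.
have nA : #|V| <= 2 * #|A| + 2 * E.
  have [x] := exS A B Abig sAB; rewrite inE => /andP[xs /seeA /(_ xs)].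
  have := splitN x; have := deg x.
  by have := subset_leq_card (subsetIr (N x) A); lia.
have dense (S B' : {set V}) : 2 * E <= #|S| -> #|seeing S B'| < E ->
    (forall x, #|N x :&: S| + #|N x :&: B'| = #|N x|) -> E <= #|seeing S S|.
  move=> Sbig small sp; apply: (@leq_trans #|S :\: seeing S B'|).
    have := cardsID (seeing S B') S.
    by have := subset_leq_card (subsetIr S (seeing S B')); lia.
  apply/subset_leq_card/subsetP => x; rewrite !inE => /andP[+ xS]; rewrite xS /= -ltnNge.
  by have := sp x; have := deg x; lia.
(* Since [x] is not its own neighbor, at most [#|A| - 1] neighbors lie in [A]; this unit yields [d]
   neighbors in [B] instead of [d - 1]. *)
have degA x : x \in A -> d <= #|[set y in B | e x y]|.
  move=> xA; rewrite -card_nbr; have := splitN x; have := deg x.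
  have : #|N x :&: A| <= #|A :\ x|.
    apply/subset_leq_card/subsetP => y; rewrite !inE => /andP[xy ->]; rewrite andbT.
    by apply: contraTneq xy => ->; rewrite eirr.
  by have := cardsD1 x A; rewrite xA; lia.
have ABdisj : [disjoint A & B] by rewrite disjoints_subset setCK.
have AV : #|V| <= 5 * #|A| by lia.
have [c /= [UB Us cov]] := wide_sets_cross D0 Dn dD ABdisj AV degA.
have [g [gc gF gW]] := hitting_extension (size_large_sets A) (leqnn d) Us cov.
exists g; apply: (color_linked_two_groups esym (hits_common gF) (hits_both gF) robA robB).
move=> T phi i j compat ci cj.
have nB x : x \in B -> (x \in A) = false by rewrite inE => /negPf.
have [a [a' [ga ga' aA a'A aa']]] := edge_of_seeing gF i j inA inA (dense _ _ Abig sAB splitN).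
have splitN' x : #|N x :&: B| + #|N x :&: A| = #|N x| by rewrite addnC.
have [b [b' [gb gb' bB b'B bb']]] := edge_of_seeing gF i j inB inB (dense _ _ Bbig sBA splitN').
(* The wide set of color [i] in [B] has a neighbor of color [j] in [A], which is the missing
   crossing edge. *)
have [x] := gW i (ltn_ord i) j; rewrite inE => /andP[xA /existsP [y /andP[xy /eqP cy]]] gx.
have gy : g y = i by apply: val_inj; rewrite /= gc cy.
have yB : y \in B by apply: (subsetP UB); rewrite inE cy.
have e1 : phi a = phi a' by apply: compat.
have e2 : phi b = phi b' by apply: compat.
have e3 : phi a = phi b.
  rewrite e1 (cj a' x) ?a'A ?xA //; rewrite (ci b y) ?nB //.
  by symmetry; apply: compat => //; rewrite esym.
have e4 : phi a = phi b' by rewrite e3.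
by exists a, a', b, b'; rewrite (nB b) ?(nB b').
Qed.

Lemma exists_color_linked : exists g : V -> 'I_d, color_linked e g.
Proof.
have degV x : #|V| <= 2 * #|N x| by have := deg x; lia.
have EV : 100 * E <= #|V| by lia.
have [A [robA robB [AT|[Abig Bbig]]]] := two_robust_groups esym E_gt0 EV degV.
  (* With a single group every pair is robust, so the extension is used with no wide sets. *)
  have U0 : #|[set y : V | 0 < 0]| <= 20 * D + 0.
    by rewrite (_ : [set y | _] = set0) ?cards0 //; apply/setP => y; rewrite !inE.
  have [//|g [_ gF _]] :=
    @hitting_extension _ (fun=> 0) 0 (fun=> set0) (size_large_sets A) (leq0n d) U0.
  exists g; apply: (color_linked_one_group (E := E) esym (hits_common gF) (hits_both gF)).
    by move=> x; rewrite /linked setIid; have := degV x; lia.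
  by move=> x y; apply: robA; rewrite AT inE.
have [AB|/ltnW BA] := leqP #|A| #|~: A|.
  exact: color_linked_of_two_groups robA robB Abig Bbig AB.
by apply: (@color_linked_of_two_groups (~: A)); rewrite ?setCK.
Qed.
End Coloring.

Local Open Scope ring_scope.

(** * Pinned infinitesimal rigidity *)

Section PinnedRigidity.
Variables (V : finType) (e : rel V) (d : nat) (rep : 'I_d -> V).

(* The pinned coordinates, one for each [i <= j], are as many as the dimension
   of the space of rigid motions. *)
Definition pinned_rigid (K : nzRingType) (X : V * 'I_d -> K) :=
  forall u : V * 'I_d -> K,
    (forall x y, e x y ->
       \sum_(k < d) (X (x, k) - X (y, k)) * (u (x, k) - u (y, k)) = 0) ->
    (forall i j : 'I_d, (i <= j)%N -> u (rep i, j) = 0) ->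
    forall c, u c = 0.

(** The rigidity matrix, with one row per ordered pair of vertices (zero off the edges), is extended
    by rows that read off the pinned coordinates. *)
Definition pinned_entry (K : nzRingType) (X : V * 'I_d -> K)
    (r : (V * V) + ('I_d * 'I_d)) (c : V * 'I_d) : K :=
  match r with
  | inl (x, y) => if e x y then ((c.1 == x)%:R - (c.1 == y)%:R) * (X (x, c.2) - X (y, c.2)) else 0
  | inr (i, j) => ((i <= j)%N && (c == (rep i, j)))%:R
  end.

Definition pinned_mx (K : nzRingType) (X : V * 'I_d -> K) :
    'M[K]_(#|{: (V * V) + ('I_d * 'I_d)}|, #|{: V * 'I_d}|) :=
  \matrix_(r, c) pinned_entry X (enum_val r) (enum_val c).

Lemma map_pinned_mx (K K' : nzRingType) (f : {rmorphism K -> K'}) (X : V * 'I_d -> K) :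
  map_mx f (pinned_mx X) = pinned_mx (f \o X).
Proof.
apply/matrixP => r c; rewrite !mxE; case: (enum_val r) => [[x y]|[i j]] /=.
  by case: (e x y); rewrite ?rmorph0 // rmorphM !rmorphB !rmorph_nat.
by rewrite rmorph_nat.
Qed.

Definition pinned_minor (K : comNzRingType) (X : V * 'I_d -> K)
    (f : 'I_#|{: V * 'I_d}| -> 'I_#|{: (V * V) + ('I_d * 'I_d)}|) : K :=
  \det (rowsub f (pinned_mx X) : 'M_#|{: V * 'I_d}|).

Section Field.
Variable K : fieldType.
Implicit Type X u : V * 'I_d -> K.

Lemma pinned_mx_mul X u (r : (V * V) + ('I_d * 'I_d)) :
  (pinned_mx X *m \col_c u (enum_val c)) (enum_rank r) 0 =
    match r with
    | inl (x, y) => if e x y then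
        \sum_(k < d) (X (x, k) - X (y, k)) * (u (x, k) - u (y, k)) else 0
    | inr (i, j) => if (i <= j)%N then u (rep i, j) else 0
    end.
Proof.
have -> : (pinned_mx X *m \col_c u (enum_val c)) (enum_rank r) 0
    = \sum_(c : V * 'I_d) pinned_entry X r c * u c.
  rewrite mxE [RHS](reindex (@enum_val _ (mem {: V * 'I_d}))) /=.
    by apply: eq_bigr => c _; rewrite !mxE enum_rankK.
  by apply: onW_bij; exact: enum_val_bij.
case: r => [[x y]|[i j]] /=.
  case: ifP => xy; last by rewrite big1 // => c _; rewrite mul0r.
  transitivity (\sum_(v : V) \sum_(k < d)
      ((v == x)%:R - (v == y)%:R) * (X (x, k) - X (y, k)) * u (v, k)).
    by rewrite pair_bigA; apply: eq_bigr => -[].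
  rewrite exchange_big /=; apply: eq_bigr => k _.
  have pick (z : V) (a : K) : \sum_v (v == z)%:R * (a * u (v, k)) = a * u (z, k).
    by rewrite (bigD1 z) //= eqxx mul1r big1 ?addr0 // => v /negPf ->; rewrite mul0r.
  rewrite mulrBr -!pick -sumrB; apply: eq_bigr => v _.
  by rewrite -mulrA mulrBl.
case: ifP => ij; last by rewrite big1 // => c _; rewrite mul0r.
rewrite (bigD1 (rep i, j)) //= eqxx mul1r big1 ?addr0 // => c /negPf ->.
by rewrite mul0r.
Qed.

Lemma pinned_rigid_kernel X :
  pinned_rigid X <-> forall w, pinned_mx X *m w = 0 -> w = 0 :> 'cV_#|{: V * 'I_d}|.
Proof.
split=> [rig w w0|ker u edges pins c].
  pose u c := w (enum_rank c) 0.
  have wE : w = \col_c u (enum_val c).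
    by apply/colP => c; rewrite mxE /u enum_valK.
  have entry := pinned_mx_mul X u; rewrite -wE w0 in entry.
  suff u0 : forall c, u c = 0 by rewrite wE; apply/colP => c; rewrite !mxE u0.
  apply: rig => [x y xy|i j ij].
    by have := entry (inl (x, y)); rewrite mxE xy.
  by have := entry (inr (i, j)); rewrite mxE ij.
suff wE : \col_c u (enum_val c) = 0 :> 'cV_#|{: V * 'I_d}|.
  by have := congr1 (fun w : 'cV_ _ => w (enum_rank c) 0) wE; rewrite !mxE enum_rankK.
apply: ker; apply/colP => r; rewrite [RHS]mxE -[r]enum_valK pinned_mx_mul.
case: (enum_val r) => [[x y]|[i j]]; case: ifP => //; [exact: edges|exact: pins].
Qed.

(** A trivial kernel means full column rank. A nonzero maximal minor is a polynomial certificate of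
    it, which passes to generic frameworks and to nearby ones. *)
Lemma pinned_rigid_minor X : pinned_rigid X ->
  exists f, pinned_minor X f != 0.
Proof.
move=> /pinned_rigid_kernel ker.
have full : row_full (pinned_mx X).
  rewrite /row_full -mxrank_tr; change (row_free (pinned_mx X)^T).
  rewrite -kermx_eq0; apply/rowV0P => w /sub_kermxP w0.
  have := ker w^T; rewrite -[pinned_mx X]trmxK -trmx_mul w0 trmx0 => /(_ erefl) wT.
  by rewrite -[w]trmxK wT trmx0.
exists (fullrankfun full); rewrite -unitfE -unitmxE -row_full_unit.
exact: fullrowsub_full.
Qed.

Lemma minor_pinned_rigid X f :
  pinned_minor X f != 0 -> pinned_rigid X.
Proof.
rewrite -unitfE -unitmxE => unit; apply/pinned_rigid_kernel => w w0.
have zero : rowsub f (0 : 'cV[K]_#|{: (V * V) + ('I_d * 'I_d)}|) = 0.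
  by apply/matrixP => i j; rewrite !mxE.
by rewrite -[w](mulKmx unit) mul_rowsub_mx w0 zero mulmx0.
Qed.

End Field.

(** Vertex [v] sits on axis [g v] at height [enum_rank v + 1]; the heights are distinct and nonzero.
    An edge then involves only the coordinates of [u] along the axes of its ends, so linkedness
    spreads the pinned zeros through each pair of classes. *)
Lemma pinned_rigid_color (K : numFieldType) (g : V -> 'I_d) :
  color_linked e g -> (forall i, g (rep i) = i) ->
  pinned_rigid (fun c => (enum_rank c.1).+1%:R * (c.2 == g c.1)%:R : K).
Proof.
move=> link repK u edges pins; pose a (v : V) : K := (enum_rank v).+1%:R.
have a0 v : a v != 0 by rewrite pnatr_eq0.
have edgeE x y : e x y -> a x * (u (x, g x) - u (y, g x)) = a y * (u (x, g y) - u (y, g y)).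
  move=> /edges /=; under eq_bigr do rewrite mulrBl.
  have pick v (w : 'I_d -> K) :
      \sum_(k < d) (enum_rank v).+1%:R * (k == g v)%:R * w k = a v * w (g v).
    by rewrite (bigD1 (g v)) //= eqxx mulr1 big1 ?addr0 // => k /negPf ->; rewrite mulr0 mul0r.
  pose du k := u (x, k) - u (y, k).
  by rewrite sumrB (pick x du) (pick y du) => /subr0_eq.
(* Inside a class the heights differ, so the coordinate of [u] along the axis of the class is
   constant along edges, and the pin at the representative makes it zero. *)
have own v : u (v, g v) = 0.
  rewrite -(pins (g v) (g v) (leqnn _)).
  apply: (link K (fun w => u (w, g v)) (g v) (g v)); rewrite ?inE ?repK ?eqxx //.
  move=> x y gx gy /edgeE; rewrite gx gy => /eqP; rewrite -subr_eq0 -mulrBl mulf_eq0.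
  case/orP => [|/eqP /subr0_eq //]; rewrite subr_eq0 eqr_nat eqSS => /eqP xy.
  by have /enum_rank_inj -> : enum_rank x = enum_rank y by apply: val_inj.
suff cross (i j : 'I_d) v : (i < j)%N -> (g v = i -> u (v, j) = 0) /\ (g v = j -> u (v, i) = 0).
  case=> v k; have [gk|gk|gk] := ltngtP (g v) k.
  - exact: (cross _ _ v gk).1.
  - exact: (cross _ _ v gk).2.
  - by have -> : k = g v by apply: val_inj.
move=> ij; have ji : (j == i) = false by apply: gtn_eqF.
(* Along an edge joining classes [i] and [j], [phi] is constant. *)
pose phi w := if g w == i then u (w, j) / a w else - (u (w, i) / a w).
have const w : g w \in [:: i; j] -> phi w = 0.
  move=> gw; transitivity (phi (rep i)).
    apply: (link K phi i j) => //; last by rewrite repK !inE eqxx.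
    move=> x y gx gy xy; rewrite /phi gx gy eqxx ji.
    have := edgeE x y xy; have := own x; have := own y; rewrite gx gy => -> ->.
    rewrite sub0r subr0 => exy; apply/eqP; rewrite -mulNr eqr_div //.
    by rewrite mulNr [u (y, i) * _]mulrC -mulrN exy mulrC.
  by rewrite /phi repK eqxx (pins i j (ltnW ij)) mul0r.
split=> gv; have := const v; rewrite gv !inE !eqxx ?orbT => /(_ isT); rewrite /phi gv ?eqxx ?ji.
  by move/eqP; rewrite mulf_eq0 invr_eq0 (negPf (a0 v)) orbF => /eqP.
by move/eqP; rewrite oppr_eq0 mulf_eq0 invr_eq0 (negPf (a0 v)) orbF => /eqP.
Qed.

End PinnedRigidity.

(** The minor is a polynomial with rational coefficients in the coordinates, the form in which
    genericity can be applied. *)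
Lemma mmap_pinned_minor (R : numFieldType) (V : finType) (e : rel V) (d : nat)
    (rep : 'I_d -> V) (X : V * 'I_d -> R) f :
  mmap (ratr : rat -> R) (fun k => X (enum_val k))
    (pinned_minor e rep
      (fun c => mpolyX rat (mnm1 (enum_rank c)) : mpoly #|{: V * 'I_d}| rat) f)
  = pinned_minor e rep X f.
Proof.
rewrite /pinned_minor -det_map_mx map_mxsub map_pinned_mx; congr (\det (rowsub f _)).
apply/matrixP => r c; rewrite !mxE; case: (enum_val r) => [[x y]|//] /=.
by rewrite !mmapX !mmap1U !enum_rankK.
Qed.

(** * Congruent frameworks and trivial infinitesimal flexes *)

Section Frames.
Variables (K : numFieldType) (V : finType) (d : nat).
Implicit Types (P Q m u : V -> 'rV[K]_d).

Definition coords P (c : V * 'I_d) : K := P c.1 0 c.2.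

Definition sq_dist (x y : 'rV[K]_d) := \sum_(k < d) (x 0 k - y 0 k) ^+ 2.

(** Invertible exactly when the points at [w0] and at the [w i] are affinely independent. *)
Definition frame (w0 : V) (w : 'I_d -> V) P : 'M[K]_d :=
  \matrix_(i, j) (P (w i) 0 j - P w0 0 j).

Lemma sq_distE (x y : 'rV[K]_d) : sq_dist x y = ((x - y) *m (x - y)^T) 0 0.
Proof. by rewrite mxE; apply: eq_bigr => k _; rewrite !mxE expr2. Qed.

Lemma skew_quadratic (S : 'M[K]_d) (z : 'rV[K]_d) :
  S^T = - S -> \sum_(k < d) z 0 k * (z *m S) 0 k = 0.
Proof.
move=> skew; have -> : \sum_(k < d) z 0 k * (z *m S) 0 k = (z *m (z *m S)^T) 0 0.
  rewrite [RHS]mxE; apply: eq_bigr => k _. by rewrite [X in _ = _ * X]mxE.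
set M := z *m _; have MT : M^T = - M.
  by rewrite /M !trmx_mul !trmxK skew mulNmx mulmxN opprK mulmxA.
have /matrixP /(_ 0 0) : M^T = - M by [].
by rewrite !mxE => /eqP; rewrite -addr_eq0 -mulr2n mulrn_eq0 => /eqP.
Qed.

Section Congruence.
Variables (w0 : V) (w : 'I_d -> V) (P Q : V -> 'rV[K]_d).
Hypothesis P_frame : frame w0 w P \in unitmx.
Hypothesis PQ : forall x y, sq_dist (P x) (P y) = sq_dist (Q x) (Q y).

Let A := invmx (frame w0 w P) *m frame w0 w Q.

Lemma gram_eq x y : (P x - P w0) *m (P y - P w0)^T = (Q x - Q w0) *m (Q y - Q w0)^T.
Proof.
apply/matrixP => i j; rewrite !ord1 {i j}.
have polar (p q z : 'rV[K]_d) : ((p - z) *m (q - z)^T) 0 0 *+ 2 =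
    sq_dist p z + sq_dist q z - sq_dist p q.
  rewrite mxE /sq_dist -sumrMnl -big_split -sumrB; apply: eq_bigr => k _.
  by rewrite !mxE -mulr_natr /=; ring.
have := polar (P x) (P y) (P w0); rewrite !PQ -(polar (Q x)) => /eqP.
by rewrite eqrMn2r => /eqP.
Qed.

Lemma row_frame (T : V -> 'rV[K]_d) i : row i (frame w0 w T) = T (w i) - T w0.
Proof. by apply/rowP => j; rewrite !mxE. Qed.

Lemma frame_gram (T T' : V -> 'rV[K]_d) (x x' : 'rV[K]_d) :
  (forall i, x *m (T (w i) - T w0)^T = x' *m (T' (w i) - T' w0)^T) ->
  x *m (frame w0 w T)^T = x' *m (frame w0 w T')^T.
Proof.
move=> eqs; apply/rowP => i.
have entry (y : 'rV[K]_d) (F : 'M[K]_d) : (y *m F^T) 0 i = (y *m (row i F)^T) 0 0.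
  by rewrite !mxE; apply: eq_bigr => j _; rewrite !mxE.
by rewrite !entry !row_frame eqs.
Qed.

(** By polarization equal distances give equal Gram matrices of the two frames, and [A] carries one
    frame to the other. *)
Lemma congruence_orthogonal : A *m A^T = 1%:M.
Proof.
have gram : frame w0 w P *m (frame w0 w P)^T = frame w0 w Q *m (frame w0 w Q)^T.
  apply/row_matrixP => i; rewrite !row_mul !row_frame.
  by apply: frame_gram => j; apply: gram_eq.
rewrite /A trmx_mul mulmxA -[_ *m _ *m (frame w0 w Q)^T]mulmxA -gram mulmxA mulVmx //.
by rewrite mul1mx -trmx_mul mulVmx // trmx1.
Qed.

(** [P v - P w0] is determined by its inner products with an invertible frame, and these agree with
    those of [Q]. *)
Lemma congruence_formula v : Q v = P v *m A + (Q w0 - P w0 *m A).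
Proof.
have AtA : A^T *m A = 1%:M by apply: mulmx1C congruence_orthogonal.
have QA : frame w0 w Q = frame w0 w P *m A by rewrite mulmxA mulmxV // mul1mx.
have gram : (P v - P w0) *m (frame w0 w P)^T = (Q v - Q w0) *m (frame w0 w Q)^T.
  by apply: frame_gram => j; apply: gram_eq.
rewrite QA trmx_mul mulmxA in gram.
have /(congr1 (mulmxr A)) /= : P v - P w0 = (Q v - Q w0) *m A^T.
  have PT : (frame w0 w P)^T \in unitmx by rewrite unitmx_tr.
  by rewrite -[LHS](mulmxK PT) gram mulmxK.
rewrite -mulmxA AtA mulmx1 mulmxBl => PQv.
by rewrite addrCA PQv addrC subrK.
Qed.
End Congruence.

Section TrivialFlexes.
Variables (e : rel V) (rep : 'I_d -> V) (w0 : V) (w : 'I_d -> V).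
Variable m : V -> 'rV[K]_d.
Hypothesis m_rigid : pinned_rigid e rep (coords m).
Hypothesis m_frame : frame w0 w m \in unitmx.

Definition flex u := forall x y, e x y ->
  \sum_(k < d) (m x 0 k - m y 0 k) * (u x 0 k - u y 0 k) = 0.

(* A square matrix encodes a trivial flex: the strict upper triangle is the
   rotation part, the diagonal the translation part. *)
Definition skew_part (C : 'M[K]_d) : 'M[K]_d :=
  \matrix_(i, j) if (i < j)%N then C i j else if (j < i)%N then - C j i else 0.

Definition trivial_flex (C : 'M[K]_d) (v : V) : 'rV[K]_d :=
  m v *m skew_part C + \row_j C j j.

(** The upper triangle holds the pinned coordinates of the trivial flex of [C]; copying the strict
    lower triangle of [C], which does not affect the flex, makes this an endomorphism, so
    injectivity implies surjectivity. *)
Definition pin_values (C : 'M[K]_d) : 'M[K]_d :=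
  \matrix_(i, j) if (i <= j)%N then trivial_flex C (rep i) 0 j else C i j.

Fact pin_values_is_linear : linear pin_values.
Proof.
move=> a C C'; apply/matrixP => i j; rewrite !mxE; case: leqP => // _.
rewrite mulrDr addrACA; congr (_ + _).
rewrite mulr_sumr -big_split; apply: eq_bigr => k _ /=; rewrite !mxE.
by case: ltngtP => _; ring.
Qed.

HB.instance Definition _ :=
  GRing.isLinear.Build K 'M[K]_d 'M[K]_d _ pin_values pin_values_is_linear.

Lemma skew_partT C : (skew_part C)^T = - skew_part C.
Proof.
by apply/matrixP => i j; rewrite !mxE; case: ltngtP; rewrite ?opprK ?oppr0.
Qed.

Lemma flex_affine S (b : 'rV[K]_d) : S^T = - S -> flex (fun v => m v *m S + b).
Proof.
move=> skew x y _; rewrite -[RHS](skew_quadratic (m x - m y) skew).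
by apply: eq_bigr => k _; rewrite mulmxBl !mxE; congr (_ * _); ring.
Qed.

Lemma flex_pinned u : flex u -> (forall i j : 'I_d, (i <= j)%N -> u (rep i) 0 j = 0) ->
  forall v, u v = 0.
Proof.
move=> fl pins v; apply/rowP => k; rewrite mxE.
exact: (m_rigid (u := coords u) fl pins (v, k)).
Qed.

Lemma pin_values_inj C : pin_values C = 0 -> C = 0.
Proof.
move=> C0; have low (i j : 'I_d) : (j < i)%N -> C i j = 0.
  by move=> ji; have := congr1 (fun M : 'M_d => M i j) C0; rewrite !mxE leqNgt ji.
have triv : forall v, trivial_flex C v = 0.
  apply: flex_pinned; first exact: flex_affine (skew_partT C).
  by move=> i j ij; have := congr1 (fun M : 'M_d => M i j) C0; rewrite mxE ij [RHS]mxE.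
have S0 : skew_part C = 0.
  suff FS : frame w0 w m *m skew_part C = 0 by rewrite -[LHS](mulKmx m_frame) FS mulmx0.
  apply/row_matrixP => i; rewrite row_mul row0.
  rewrite row_frame mulmxBl; apply/eqP; rewrite subr_eq0; apply/eqP.
  by apply: (addIr (\row_j C j j)); rewrite -/(trivial_flex C (w i)) -/(trivial_flex C w0) !triv.
apply/matrixP => i j; rewrite [RHS]mxE; have [ij|ji|ij] := ltngtP i j.
- by have := congr1 (fun M : 'M_d => M i j) S0; rewrite !mxE ij.
- exact: low.
- have := triv w0; rewrite /trivial_flex S0 mulmx0 add0r => /rowP /(_ i).
  by rewrite !mxE (_ : j = i) //; apply: val_inj.
Qed.

(** Some trivial flex has the same pinned coordinates as [u], because [pin_values] is onto; the
    difference is a pinned flex and vanishes. *)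
Lemma flex_trivial u : flex u ->
  exists S b, S^T = - S /\ forall v, u v = m v *m S + b.
Proof.
move=> fl; have inj : lker (linfun pin_values) == 0%VS.
  apply/lker0P => C C'; rewrite !lfunE /= => CC'.
  by apply/subr0_eq/pin_values_inj; rewrite raddfB /= CC' subrr.
pose T : 'M[K]_d := \matrix_(i, j) if (i <= j)%N then u (rep i) 0 j else 0.
have [C CT] : exists C, pin_values C = T.
  by exists ((linfun pin_values)^-1%VF T); have := lker0_lfunVK inj T; rewrite lfunE.
exists (skew_part C), (\row_j C j j); split=> [|v]; first exact: skew_partT.
apply/subr0_eq; apply: (flex_pinned (u := fun v => u v - trivial_flex C v)).
  move=> x y xy; have := flex_affine (\row_j C j j) (skew_partT C) xy.
  rewrite -/(trivial_flex C x) -/(trivial_flex C y) => fC.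
  rewrite -[RHS](subr0 0) -[X in _ = X - _](fl x y xy) -[X in _ = _ - X]fC -sumrB.
  by apply: eq_bigr => k _; rewrite !mxE; ring.
move=> i j ij; have := congr1 (fun M : 'M_d => M i j) CT.
by rewrite !mxE ij => <-; rewrite subrr.
Qed.
End TrivialFlexes.

(* [|x - y|^2 - |x' - y'|^2] is bilinear in the sum and the difference of the
   two frameworks, so the difference is an infinitesimal flex of the midpoint. *)
Lemma midpoint_congruence (e : rel V) rep w0 w P Q :
  let m v := 2^-1 *: (P v + Q v) in
  pinned_rigid e rep (coords m) -> frame w0 w m \in unitmx ->
  (forall x y, e x y -> sq_dist (P x) (P y) = sq_dist (Q x) (Q y)) ->
  forall x y, sq_dist (P x) (P y) = sq_dist (Q x) (Q y).
Proof.
move=> m rig fr edges.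
have two : (2 : K) != 0 by rewrite pnatr_eq0.
have diff x y : sq_dist (P x) (P y) - sq_dist (Q x) (Q y) =
    2 * \sum_(k < d) (m x 0 k - m y 0 k) * ((P x - Q x) 0 k - (P y - Q y) 0 k).
  rewrite /sq_dist -sumrB mulr_sumr; apply: eq_bigr => k _; rewrite !mxE.
  by field.
have fl : flex e m (fun v => P v - Q v).
  move=> x y xy; apply/eqP; rewrite -(mulrI_eq0 _ (mulfI two)) -diff edges //.
  by rewrite subrr.
have [S [b [skew uE]]] := flex_trivial rig fr fl.
move=> x y; apply/subr0_eq; rewrite diff; apply/eqP; rewrite mulf_eq0; apply/orP; right.
apply/eqP; rewrite -[RHS](skew_quadratic (m x - m y) skew).
by apply: eq_bigr => k _; rewrite !uE mulmxBl !mxE; congr (_ * _); ring.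
Qed.
End Frames.

(** * Continuous motions *)

From mathcomp Require Import all_classical all_reals all_analysis.
Import Order.TTheory GRing.Theory Num.Theory numFieldNormedType.Exports.

Section RealMotions.
Variable R : realType.
Local Open Scope classical_set_scope.
Local Open Scope ring_scope.

Lemma continuous_mx (m n : nat) (f : R -> 'M[R]_(m, n)) :
  (forall i j, continuous (fun t => f t i j)) -> continuous f.
Proof.
move=> fij t A [P Pf PA].
have : \forall s \near t, forall i j, P i j (f s i j).
  have FF : Filter (nbhs t) by exact: nbhs_filter.
  apply: (@filter_forall _ _ (fun i s => forall j, P i j (f s i j)) _ FF) => i.
  apply: (@filter_forall _ _ (fun j s => P i j (f s i j)) _ FF) => j.
  exact: (fij i j t _ (Pf i j)).
by apply: filterS => s Ps; apply: PA.
Qed.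

Lemma continuous_sum_prod (n : nat) (f : 'I_n -> R -> R) :
  (forall i, continuous (f i)) ->
  continuous (fun t => \sum_i f i t) /\ continuous (fun t => \prod_i f i t).
Proof.
move=> cf; split; apply: continuous_big => // x.
- exact: add_continuous.
- exact: mul_continuous.
Qed.

Lemma continuous_det (n : nat) (f : R -> 'M[R]_n) :
  (forall i j, continuous (fun t => f t i j)) -> continuous (fun t => \det (f t)).
Proof.
move=> fij; rewrite /determinant.
apply: continuous_big => [x|s _]; first exact: add_continuous.
move=> t; apply: cvgM; first exact: cvg_cst.
by apply: (continuous_sum_prod _).2 => i; exact: fij.
Qed.

(** Precomposing with [clamp] extends a motion from the unit interval to all of [R], where
    continuity is unrestricted. *)
Definition clamp (t : R) : R := Num.max 0 (Num.min 1 t).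

Lemma clamp_in t : clamp t \in `[0, 1].
Proof.
by rewrite in_itv /= /clamp le_max lexx /= ge_max ler01 ge_min lexx.
Qed.

Lemma clampE t : t \in `[0, 1] -> clamp t = t.
Proof.
by rewrite in_itv /= => /andP[t0 t1]; rewrite /clamp (min_r t1) (max_r t0).
Qed.

Lemma continuous_clamp : continuous clamp.
Proof.
move=> t; apply: continuous_max; first exact: cvg_cst.
by apply: continuous_min; [exact: cvg_cst|exact: cvg_id].
Qed.

Lemma continuous_comp_clamp (T : topologicalType) (f : R -> T) :
  {within `[0, 1], continuous f} -> continuous (f \o clamp).
Proof.
move=> /subspace_continuousP cf t A nA.
have near_clamp : nbhs (clamp t) [set s | s \in `[0, 1] -> A (f s)].
  by have := cf (clamp t) (clamp_in t) A nA.
have FF : Filter (nbhs t) by exact: nbhs_filter.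
have := continuous_clamp near_clamp.
by apply: (@filterS _ _ FF) => s; apply; exact: clamp_in.
Qed.
End RealMotions.

Section Motions.
Variables (R : realType) (V : finType) (e : rel V) (d : nat).
Variables (p : V -> 'rV[R]_d) (rep : 'I_d -> V) (w0 : V) (w : 'I_d -> V).
Variable f : 'I_#|{: V * 'I_d}| -> 'I_#|{: (V * V) + ('I_d * 'I_d)}|.
Hypothesis p_minor : pinned_minor e rep (coords p) f != 0.
Hypothesis p_frame : \det (frame w0 w p) != 0.
Local Open Scope classical_set_scope.
Local Open Scope ring_scope.

Lemma eucl_dist_sq (x y x' y' : 'rV[R]_d) :
  eucl_dist x y = eucl_dist x' y' -> sq_dist x y = sq_dist x' y'.
Proof.
have ge0 (a b : 'rV[R]_d) : 0 <= sq_dist a b.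
  by apply: sumr_ge0 => k _; apply: sqr_ge0.
by move=> eq_d; rewrite -[LHS]sqr_sqrtr // -[RHS]sqr_sqrtr //; congr (_ ^+ 2).
Qed.

Variable q : R -> V -> 'rV[R]_d.
Hypothesis q_cont : forall v k, continuous (fun t => q t v 0 k).
Hypothesis q_start : forall v, q 0 v = p v.
Hypothesis q_edges : forall t x y, e x y -> sq_dist (p x) (p y) = sq_dist (q t x) (q t y).

Let A t := invmx (frame w0 w p) *m frame w0 w (q t).
Let b t := q t w0 - p w0 *m A t.
Let congruent t := forall x y, sq_dist (p x) (p y) = sq_dist (q t x) (q t y).

Let frame_unit : frame w0 w p \in unitmx.
Proof. by rewrite unitmxE unitfE. Qed.

Lemma continuous_sq_dist x y : continuous (fun t => sq_dist (q t x) (q t y)).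
Proof.
apply: (continuous_sum_prod _).1 => k t; under eq_fun do rewrite expr2.
by apply: cvgM; apply: cvgB; apply: q_cont.
Qed.

Lemma continuous_moving_frame i j : continuous (fun t => A t i j).
Proof.
have -> : (fun t => A t i j) =
    fun t => \sum_k invmx (frame w0 w p) i k * (q t (w k) 0 j - q t w0 0 j).
  by apply/funext => t; rewrite mxE; apply: eq_bigr => k _; rewrite [frame _ _ (q t) _ _]mxE.
apply: (continuous_sum_prod _).1 => k t; apply: cvgM; first exact: cvg_cst.
by apply: cvgB; apply: q_cont.
Qed.

(** Move [q t] back by the congruence at time [s]. The midpoint with [p] then equals [p] at [t = s],
    so nearby it keeps a nonzero minor and an invertible frame, and the midpoint argument
    applies. *)
Lemma congruent_near s : congruent s -> \forall t \near s, congruent t.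
Proof.
move=> cs; have [a [c [aat qs]]] : exists (a : 'M[R]_d) (c : 'rV[R]_d),
    a *m a^T = 1%:M /\ forall v, q s v = p v *m a + c.
  exists (A s), (b s); split; first exact: congruence_orthogonal frame_unit cs.
  exact: congruence_formula frame_unit cs.
have ata : a^T *m a = 1%:M by apply: mulmx1C aat.
pose y t v := (q t v - c) *m a^T.
have y_start v : y s v = p v by rewrite /y qs addrK -mulmxA aat mulmx1.
pose m t v := 2^-1 *: (p v + y t v).
have m_start v : m s v = p v.
  by rewrite /m y_start -mulr2n -scalerMnr scalerMnl -[_ *+ 2]mulr_natr mulVf ?scale1r ?pnatr_eq0.
have y_dist t x z : sq_dist (y t x) (y t z) = sq_dist (q t x) (q t z).
  have shift (u v r : 'rV[R]_d) : (u - r) - (v - r) = u - v by rewrite opprB addrA subrK.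
  rewrite !sq_distE /y -mulmxBl shift trmx_mul trmxK.
  by rewrite -mulmxA [_^T *m (_ *m _)]mulmxA ata mul1mx.
have m_cont v k : continuous (fun t => m t v 0 k).
  have -> : (fun t => m t v 0 k) = fun t =>
      2^-1 * (p v 0 k + \sum_j (q t v 0 j - c 0 j) * a k j).
    apply/funext => t; rewrite !mxE; congr (_ * (_ + _)).
    by apply: eq_bigr => j _; rewrite [_^T _ _]mxE !mxE.
  move=> t; apply: cvgM; first exact: cvg_cst.
  apply: cvgD; first exact: cvg_cst.
  apply: (continuous_sum_prod _).1 => j {}t; apply: cvgM; last exact: cvg_cst.
  by apply: cvgB; [exact: q_cont|exact: cvg_cst].
have FF : Filter (nbhs s) by exact: nbhs_filter.
have minor_near : \forall t \near s, pinned_minor e rep (coords (m t)) f != 0.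
  have cs_m : coords (m s) = coords p by apply/funext => xk; rewrite /coords m_start.
  apply: (@cvgr_neq0 _ _ _ (nbhs s) FF _ (pinned_minor e rep (coords (m s)) f));
    last by rewrite cs_m.
  apply: continuous_det => i j.
  have -> : (fun t => rowsub f (pinned_mx e rep (coords (m t))) i j) =
      fun t => pinned_entry e rep (coords (m t)) (enum_val (f i)) (enum_val j).
    by apply/funext => t; rewrite !mxE.
  case: (enum_val _) => [[x z]|[x z]] t /=; last exact: cvg_cst.
  case: (e x z); last exact: cvg_cst.
  by apply: cvgM; [exact: cvg_cst|apply: cvgB; apply: m_cont].
have frame_near : \forall t \near s, \det (frame w0 w (m t)) != 0.
  have fs_m : frame w0 w (m s) = frame w0 w p.
    by apply/matrixP => i j; rewrite [LHS]mxE [RHS]mxE !m_start.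
  apply: (@cvgr_neq0 _ _ _ (nbhs s) FF _ (\det (frame w0 w (m s)))); last by rewrite fs_m.
  apply: continuous_det => i j.
  have -> : (fun t => frame w0 w (m t) i j) = fun t => m t (w i) 0 j - m t w0 0 j.
    by apply/funext => t; rewrite mxE.
  by move=> t; apply: cvgB; apply: m_cont.
near=> t => x z; rewrite -y_dist.
apply: (@midpoint_congruence _ _ _ e rep w0 w).
- by apply: (@minor_pinned_rigid _ _ _ _ _ _ f); near: t.
- by rewrite unitmxE unitfE; near: t.
- by move=> x' z' xz; rewrite y_dist; apply: q_edges.
Unshelve. all: by end_near. Qed.

(** The set of congruent times contains [0], is open by [congruent_near], and is closed as an
    intersection of preimages of points; the line is connected. *)
Lemma congruent_always t : congruent t.
Proof.
suff BT : [set t | congruent t] = setT.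
  by have : [set t | congruent t] t by rewrite BT.
have conn : connected [set: R] by apply/connected_intervalP.
apply: conn.
- by exists 0 => x y; rewrite !q_start.
- exists [set t | congruent t]; last by rewrite setTI.
  by rewrite openE => s; apply: congruent_near.
- exists [set t | congruent t]; last by rewrite setTI.
  have -> : [set t | congruent t] = \bigcap_(xy in [set: V * V])
      (fun t => sq_dist (q t xy.1) (q t xy.2)) @^-1` [set r | r = sq_dist (p xy.1) (p xy.2)].
    apply/seteqP; split=> [s cs [x y] _ /=|s cs x y]; first by rewrite cs.
    by rewrite -(cs (x, y)).
  apply: closed_bigI => -[x y] _.
  have cont : continuous (fun t => sq_dist (q t x) (q t y)) by exact: continuous_sq_dist.
  by move/continuous_closedP: cont; apply; exact: closed_eq.
Qed.

Lemma moving_frame_orthogonal t : A t *m (A t)^T = 1%:M.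
Proof. exact: congruence_orthogonal frame_unit (congruent_always t). Qed.

(** The determinant is continuous with values [1] and [-1] and starts at [1]; a change of sign would
    force a zero in between. *)
Lemma det_moving_frame t : 0 <= t -> \det (A t) = 1.
Proof.
move=> t0; have sq s : \det (A s) = 1 \/ \det (A s) = -1.
  have /(congr1 determinant) := moving_frame_orthogonal s.
  rewrite det_mulmx det_tr det1 -expr2 => /eqP; rewrite sqrf_eq1.
  by case/orP => /eqP ->; [left|right].
have A0 : \det (A 0) = 1.
  have -> : A 0 = 1%:M; last by rewrite det1.
  rewrite /A; have -> : frame w0 w (q 0) = frame w0 w p; last by rewrite mulVmx.
  by apply/matrixP => i j; rewrite [LHS]mxE [RHS]mxE !q_start.
have [//|At] := sq t.
have dcont : {within `[0, t], continuous (fun s => \det (A s))}.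
  by apply/continuous_subspaceT/continuous_det; apply: continuous_moving_frame.
have [|s _ s0] := IVT (v := 0) t0 dcont.
  by rewrite A0 At min_r ?max_l ?oppr_le0 ?ler01 // ?lerN10 // ge0_cp.
by case: (sq s); rewrite s0 => /eqP; rewrite eq_sym ?oppr_eq0 oner_eq0.
Qed.

Lemma motion_formula t v : q t v = p v *m A t + b t.
Proof. exact: congruence_formula frame_unit (congruent_always t) v. Qed.

Lemma continuous_moving_matrix : continuous A.
Proof. by apply: continuous_mx; apply: continuous_moving_frame. Qed.

Lemma continuous_translation : continuous b.
Proof.
apply: continuous_mx => i j; rewrite ord1.
have -> : (fun t => b t 0 j) = fun t => q t w0 0 j - \sum_k p w0 0 k * A t k j.
  by apply/funext => t; rewrite !mxE.
move=> t; apply: cvgB; first exact: q_cont.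
apply: (continuous_sum_prod _).1 => k {}t; apply: cvgM; first exact: cvg_cst.
exact: continuous_moving_frame.
Qed.

End Motions.

Lemma rigid_of_minor (R : realType) (V : finType) (e : rel V) (d : nat)
    (p : V -> 'rV[R]_d) (rep : 'I_d -> V) (w0 : V) (w : 'I_d -> V) f :
  pinned_minor e rep (coords p) f != 0 -> \det (frame w0 w p) != 0 -> rigid e p.
Proof.
move=> p_minor p_frame q [qcont q0 qe].
have in0 : (0 : R) \in `[0, 1] by rewrite in_itv /= lexx ler01.
pose q' t := q (clamp t).
have q'_cont v k : continuous (fun t => q' t v 0 k).
  move=> t; apply: (@continuous_comp _ _ _ (fun t => q' t v) (fun x : 'rV_d => x 0 k)).
    exact: (continuous_comp_clamp (qcont v)).
  exact: coord_continuous.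
have q'0 v : q' 0 v = p v by rewrite /q' clampE.
have q'e t x y : e x y -> sq_dist (p x) (p y) = sq_dist (q' t x) (q' t y).
  by move=> xy; apply/esym/eucl_dist_sq/qe; rewrite ?clamp_in.
exists (fun t => invmx (frame w0 w p) *m frame w0 w (q' t)).
exists (fun t => q' t w0 - p w0 *m (invmx (frame w0 w p) *m frame w0 w (q' t))).
split.
- by apply: continuous_subspaceT; apply: continuous_moving_matrix.
- by apply: continuous_subspaceT; apply: continuous_translation.
move=> t t01; split.
  have orth := moving_frame_orthogonal p_minor p_frame q'_cont q'0 q'e t.
  split; first exact: orth.
  apply: (det_moving_frame p_minor p_frame q'_cont q'0 q'e).
  by move: t01; rewrite in_itv => /andP[].
move=> v; have <- : q' t v = q t v by rewrite /q' clampE.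
exact: (motion_formula p_minor p_frame q'_cont q'0 q'e).
Qed.

(** If no vertex had color [i], no edge would join color [i] to any class, so linkedness with [phi]
    the identity would leave at most one vertex per class. *)
Lemma color_linked_surjective (V : finType) (e : rel V) (d : nat) (g : V -> 'I_d) :
  (d < #|V|)%N -> color_linked e g -> forall i, exists v, g v = i.
Proof.
move=> dV link i; have [|none] := pselect (exists v, g v = i); first by [].
suff /leq_card : injective g by rewrite card_ord leqNgt dV.
move=> x y gxy; apply: (link V id i (g y)); rewrite ?gxy ?inE ?eqxx ?orbT // => u v gu.
by case: none; exists u.
Qed.

(** * From one special framework to every generic one *)

Section GenericFrameworks.
Variables (R : realType) (V : finType) (d : nat).

(** A value other than zero at the single point [X0] shows that [P] is not the zero polynomial. *)
Lemma generic_neq0 (p : V -> 'rV[R]_d) (P : mpoly #|{: V * 'I_d}| rat) (X0 : V * 'I_d -> R) :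
  generic p -> mmap (ratr : rat -> R) (fun k => X0 (enum_val k)) P != 0 ->
  mmap (ratr : rat -> R) (fun k => coords p (enum_val k)) P != 0.
Proof.
by move=> gen; apply: contra_neq => /gen ->; rewrite raddf0.
Qed.

Lemma generic_frame (p : V -> 'rV[R]_d) (w0 : V) (w : 'I_d -> V) :
  injective w -> (forall i, w i != w0) -> generic p -> \det (frame w0 w p) != 0.
Proof.
move=> w_inj ww0 gen.
pose X (c : V * 'I_d) : mpoly #|{: V * 'I_d}| rat := mpolyX rat (mnm1 (enum_rank c)).
pose P := \det (\matrix_(i, j) (X (w i, j) - X (w0, j))).
have evalP (Y : V * 'I_d -> R) : mmap (ratr : rat -> R) (fun k => Y (enum_val k)) P
    = \det (\matrix_(i, j) (Y (w i, j) - Y (w0, j))).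
  rewrite -det_map_mx; congr (\det _); apply/matrixP => i j.
  by rewrite !mxE rmorphB /= !mmapX !mmap1U !enum_rankK.
have -> : frame w0 w p = \matrix_(i, j) (coords p (w i, j) - coords p (w0, j)) by [].
(* The test framework puts [w i] at the [i]-th unit vector and [w0] at the origin. *)
pose X0 (c : V * 'I_d) : R := (c.1 == w c.2)%:R.
rewrite -evalP; apply: (generic_neq0 (X0 := X0) gen); rewrite evalP.
rewrite (_ : \matrix_(i, j) _ = 1%:M) ?det1 ?oner_eq0 //.
apply/matrixP => i j; rewrite !mxE /X0 /= [w0 == _]eq_sym (negPf (ww0 j)) subr0.
by rewrite (inj_eq w_inj).
Qed.

Lemma d_rigid_of_color_linked (e : rel V) (g : V -> 'I_d) :
  (d < #|V|)%N -> color_linked e g -> d_rigid R d e.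
Proof.
move=> dV link p gen.
have /fin_all_exists [rep repK] := color_linked_surjective dV link.
have [f f0] := pinned_rigid_minor (pinned_rigid_color (K := R) link repK).
pose w0 : V := enum_val (Ordinal (leq_ltn_trans (leq0n d) dV)).
pose w (i : 'I_d) : V := enum_val (Ordinal (leq_ltn_trans (ltn_ord i) dV)).
apply: (@rigid_of_minor _ _ _ _ p rep w0 w f).
  rewrite -mmap_pinned_minor; apply: generic_neq0 gen _.
  by rewrite mmap_pinned_minor; exact: f0.
apply: generic_frame => // [i j /enum_val_inj [ij]|i]; first exact: val_inj.
by apply/eqP => /enum_val_inj [].
Qed.
End GenericFrameworks.

(** * Numerical estimates and choice of the constants *)

Lemma min_degree_le (V : finType) (e : rel V) (v : V) : (min_degree e <= degree e v)%N.
Proof.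
rewrite /min_degree; have := mem_index_enum v; elim: (index_enum V) => // x r IH.
rewrite inE big_cons geq_min => /orP[/eqP ->|/IH ->]; by rewrite ?leqnn ?orbT.
Qed.

(** Since [1 - 1/d <= exp (- 1/d)], the failure probability is at most [exp (- D/d) <= n^-4], while
    [10 * d * n^2 <= 10 * n^3 < n^4]. *)
Lemma few_bad_colorings (R : realType) (n d D : nat) :
  (10 < n)%N -> (0 < d <= n)%N -> 4 * ln (n%:R : R) * d%:R <= D%:R ->
  (d * (10 * n ^ 2) * d.-1 ^ D < d ^ D)%N.
Proof.
move=> n10 /andP[d0 dn] big.
have dR : 0 < d%:R :> R by rewrite ltr0n.
have nR : 0 < n%:R :> R by rewrite ltr0n; lia.
pose E : R := expR (- d%:R^-1 * D%:R).
have pow : (d.-1%:R : R) ^+ D <= d%:R ^+ D * E.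
  have -> : E = expR (- d%:R^-1) ^+ D by rewrite /E expRM_natr.
  rewrite -exprMn; apply: lerXn2r; rewrite ?nnegrE ?ler0n ?mulr_ge0 ?expR_ge0 //.
  have -> : d.-1%:R = d%:R * (1 + - d%:R^-1) :> R.
    by rewrite mulrDr mulr1 mulrN divff ?gt_eqF // -[in RHS](prednK d0) -natr1 addrK.
  by rewrite ler_wpM2l ?ler0n // expR_ge1Dx.
have small : n%:R ^+ 4 * E <= 1.
  rewrite -{1}[n%:R](lnK (R := R)) ?posrE // -expRM_natl -expRD -[leRHS]expR0 ler_expR.
  by rewrite mulNr subr_le0 [_^-1 * _]mulrC ler_pdivlMr.
rewrite -(ltr_nat R) !natrM !natrX.
apply: (@le_lt_trans _ _ (d%:R * (10 * n%:R ^+ 2) * (d%:R ^+ D * E))).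
  by apply: ler_wpM2l pow; rewrite !mulr_ge0 ?exprn_ge0 ?ler0n.
have E0 : 0 < E by exact: expR_gt0.
have key : d%:R * (10 * n%:R ^+ 2) * E < 1 :> R.
  apply: lt_le_trans small; rewrite ltr_pM2r //.
  rewrite -!natrX -!natrM ltr_nat mulnA (_ : n ^ 4 = n * n * n ^ 2)%N; last by rewrite mulnn -expnD.
  by rewrite ltn_pmul2r ?expn_gt0; nia.
rewrite [ltLHS](_ : _ = d%:R ^+ D * (d%:R * (10 * n%:R ^+ 2) * E)); last by ring.
by rewrite -[ltRHS]mulr1 ltr_pM2l // exprn_gt0.
Qed.

Theorem theorem1p2 (R : realType) :
  exists (c : R) (n0 : nat),
    [/\ 0 < c, (2 <= n0)%N &
      forall n d : nat, (n0 <= n)%N -> (1 <= d)%N ->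
        d%:R <= c * n%:R / (ln (n%:R : R)) ^+ 2 ->
        forall (V : finType) (e : rel V),
          symmetric e -> irreflexive e -> #|V| = n ->
          (n%:R + 2 * d%:R) / 2 - 1 <= (min_degree e)%:R :> R ->
          d_rigid R d e].
Proof.
(* Taking [n] at least [e] makes the logarithm at least [1], so that it is bounded by its square. *)
have [N0 eN0] : exists N0 : nat, expR 1 <= N0%:R :> R.
  by exists (Num.bound (expR 1 : R)); apply/ltW/archi_boundP/expR_ge0.
exists (20000%:R^-1), (2500 + N0)%N; split; [by rewrite invr_gt0 ltr0n|by lia|].
move=> n d n0 d1 dc V e esym eirr Vn degn.
set L := ln (n%:R : R) in dc.
have n_gt0 : 0 < n%:R :> R by rewrite ltr0n; lia.
have L1 : 1 <= L.
  rewrite -ler_expR lnK ?posrE //; apply: le_trans eN0 _.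
  by rewrite ler_nat; lia.
have dL : 20000%:R * (d%:R * L ^+ 2) <= n%:R :> R.
  move: dc; rewrite ler_pdivlMr ?exprn_gt0 ?(lt_le_trans ltr01 L1) //.
  by rewrite -ler_pdivrMl ?invr_gt0 ?ltr0n // invrK.
have L2 : 1 <= L ^+ 2 by rewrite exprn_ege1.
have d_le : (20000 * d <= n)%N.
  rewrite -(ler_nat R) natrM; apply: le_trans dL.
  by rewrite ler_wpM2l ?ler0n // ler_peMr ?ler0n.
(* The largest [D] with [2500 * D <= n]. Rounding loses at most a factor two, and
   [4 * d * L <= n / 5000 <= D] explains the constant [20000]. *)
pose D := (n %/ 2500)%N.
have nD : (n <= 5000 * D)%N by rewrite /D; lia.
have dD : (d <= D)%N.
  by rewrite /D leq_divRL // mulnC (leq_trans _ d_le) // leq_mul2r orbT.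
have Dn : (2500 * D <= #|V|)%N by rewrite Vn /D; lia.
have deg x : (#|V| + 2 * d <= 2 * #|nbrs e x| + 2)%N.
  have := min_degree_le e x; rewrite -(ler_nat R) => /(le_trans degn).
  rewrite Vn -(ler_nat R) !natrD /degree -/(nbrs e x).
  set k := (#|_|%:R : R); lra.
have few : (d * (10 * #|V| ^ 2) * d.-1 ^ D < d ^ D)%N.
  rewrite Vn; apply: (@few_bad_colorings R); [lia|lia|].
  have nDR : n%:R <= 5000%:R * D%:R :> R by rewrite -natrM ler_nat.
  have LL : d%:R * L <= d%:R * L ^+ 2.
    by rewrite ler_wpM2l ?ler0n // expr2 ler_peMr // (le_trans ler01 L1).
  rewrite -/L -mulrA [L * _]mulrC.
  move: (d%:R * L) (d%:R * L ^+ 2) LL dL => u v LL dL; lra.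
have [g link] := exists_color_linked esym eirr d1 dD Dn deg few.
by apply: d_rigid_of_color_linked link; rewrite Vn; lia.
Qed.
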